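(* Let $\lambda\in\Omega:=\{\lambda\in\mathbb{C}: \mu(\lambda),\nu(\lambda)\in\mathbb{C}\}$ (i.e. $\lambda$ is not a pole of $\mu$ or $\nu$) and suppose $\lambda$ is not an eigenvalue of the boundary value problem (P) (defined in the context). Then the Green's function of (P) is given by $$G(x,t;\lambda)=\begin{cases}\dfrac{u(x;\lambda)v(t;\lambda)}{\psi(\lambda)}, & x<t,\ x,t\in[-a,0)\cup(0,b],\\[2mm] \dfrac{u(t;\lambda)v(x;\lambda)}{\psi(\lambda)}, & t<x,\ x,t\in[-a,0)\cup(0,b],\end{cases}$$ in the sense that if $h\in L^2(-a,b)$ then $$g(x;\lambda)=\int_{-a}^b G(x,t;\lambda)h(t)\,dt$$ is a solution of $(\lambda-\ell)g=h$ on $(-a,0)$ and $(0,b)$ such that $g$ obeys the boundary conditions $g(-a)\cos\alpha=g'(-a)\sin\alpha$, $g(b)\cos\beta=g'(b)\sin\beta$ and the transmission conditions $g(0^+)\mu(\lambda)=\Delta' g$, $g'(0^-)\nu(\lambda)=\Delta g$.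
   Context: Let $a,b>0$, $q\in L^2(-a,b)$, $\alpha\in[0,\pi)$, $\beta\in(0,\pi]$, and $\ell y:=-y''+qy$. Let $N,M\in\mathbb{N}_0$ (empty sums are $0$), $\eta,\kappa\ge 0$, $\xi,\zeta\in\mathbb{R}$, real numbers $c_1<\dots<c_N$ and $d_1<\dots<d_M$, and $b_i>0$ ($i=1,\dots,N$), $a_j>0$ ($j=1,\dots,M$). Put $$\mu(\lambda)=-\Big(\lambda\eta-\xi-\sum_{i=1}^N\frac{b_i^2}{\lambda-c_i}\Big),\qquad \nu(\lambda)=\lambda\kappa+\zeta-\sum_{j=1}^M\frac{a_j^2}{\lambda-d_j}.$$ For a function $y$ on $(-a,0)\cup(0,b)$ write $y(0^\pm),y'(0^\pm)$ for one-sided limits at $0$, $\Delta y=y(0^+)-y(0^-)$, $\Delta' y=y'(0^+)-y'(0^-)$. Problem (P) with spectral parameter $\lambda\in\mathbb{C}$: $\ell y=\lambda y$ on $(-a,0)$ and on $(0,b)$, with $y,y',\ell y$ restricted to $(-a,0)$ in $L^2(-a,0)$ and restricted to $(0,b)$ in $L^2(0,b)$; boundary conditions $y(-a)\cos\alpha=y'(-a)\sin\alpha$ and $y(b)\cos\beta=y'(b)\sin\beta$; transmission conditions $y(0^+)\mu(\lambda)=\Delta' y$ and $y'(0^-)\nu(\lambda)=\Delta y$. If $\lambda$ is a pole of $\mu$, the first transmission condition is read as $y(0^+)=0$; if $\lambda$ is a pole of $\nu$, the second is read as $y'(0^-)=0$. $\lambda$ is an eigenvalue if (P) has a non-zero solution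 $y$. For $\lambda\in\Omega$ let $T=\begin{bmatrix}1&\nu(\lambda)\\ \mu(\lambda)&1+\mu(\lambda)\nu(\lambda)\end{bmatrix}$. The function $u(\cdot;\lambda)$ is the solution of $\ell u=\lambda u$ on $[-a,0)$ with $u(-a;\lambda)=\sin\alpha$, $u'(-a;\lambda)=\cos\alpha$, extended to $(0,b]$ as the solution of $\ell u=\lambda u$ with $\begin{bmatrix}u(0^+;\lambda)\\ u'(0^+;\lambda)\end{bmatrix}=T\begin{bmatrix}u(0^-;\lambda)\\ u'(0^-;\lambda)\end{bmatrix}$. The function $v(\cdot;\lambda)$ is the solution of $\ell v=\lambda v$ on $(0,b]$ with $v(b;\lambda)=\sin\beta$, $v'(b;\lambda)=\cos\beta$, extended to $[-a,0)$ as the solution of $\ell v=\lambda v$ with $\begin{bmatrix}v(0^-;\lambda)\\ v'(0^-;\lambda)\end{bmatrix}=T^{-1}\begin{bmatrix}v(0^+;\lambda)\\ v'(0^+;\lambda)\end{bmatrix}$. The Wronskian $W[u,v]=uv'-u'v$ is constant on $[-a,0)\cup(0,b]$ (as $\det T=1$), and $\psi(\lambda):=W[u,v]$. *)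

(* Defs.v *)
From HB Require Import structures.
From mathcomp Require Import all_boot all_order all_algebra.
From mathcomp Require Import complex.
From mathcomp Require Import all_classical all_reals all_analysis.

Set Implicit Arguments.
Unset Strict Implicit.
Unset Printing Implicit Defensive.

Import Order.TTheory GRing.Theory Num.Theory.
Import numFieldNormedType.Exports.

Local Open Scope classical_set_scope.
Local Open Scope ring_scope.
Local Open Scope complex_scope.

(** * Integration and differentiation of functions [R -> R[i]] *)

Definition complex_integrable (R : realType) (D : set R) (f : R -> R[i]) : Prop :=
  (@lebesgue_measure R).-integrable D (fun x => (complex.Re (f x))%:E) /\
  (@lebesgue_measure R).-integrable D (fun x => (complex.Im (f x))%:E).

Definition complex_integral (R : realType) (D : set R) (f : R -> R[i]) : R[i] :=
  (\int[@lebesgue_measure R]_(x in D) complex.Re (f x)) +i*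
  (\int[@lebesgue_measure R]_(x in D) complex.Im (f x)).

(* Elements of L^2 are represented by Borel measurable functions. *)
Definition square_integrable (R : realType) (D : set R) (f : R -> R[i]) : Prop :=
  [/\ measurable_fun D (fun x => complex.Re (f x)),
      measurable_fun D (fun x => complex.Im (f x)) &
      (@lebesgue_measure R).-integrable D
        (fun x => (complex.Re (f x) ^+ 2 + complex.Im (f x) ^+ 2)%:E)].

(* [R[i]^o] carries the topology of the complex modulus. Restricting the
   limit to [J] makes the derivative one-sided at an endpoint belonging to
   [J], and the usual two-sided one at interior points. *)
Definition has_derivative_in (R : realType) (J : set R) (f : R -> R[i])
    (x : R) (d : R[i]) : Prop :=
  ((z - x)^-1)%:C * (f z - f x) @[z --> within J x^'] --> (d : R[i]^o).

(* The intervals [[s i, t i]] are listed in increasing order; they do not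
   overlap but may share endpoints. The order and the norm are those of
   [R[i]], in which the norm is a nonnegative real element. *)
Definition absolutely_continuous_on (R : realType) (l r : R) (f : R -> R[i]) : Prop :=
  forall e : R, 0 < e -> exists2 delta : R, 0 < delta &
    forall (n : nat) (s t : 'I_n -> R),
      (forall i, l <= s i /\ s i <= t i /\ t i <= r) ->
      (forall i j : 'I_n, (i < j)%N -> t i <= s j) ->
      \sum_(i < n) (t i - s i) < delta ->
      \sum_(i < n) `|f (t i) - f (s i)| < e%:C.

Definition locally_absolutely_continuous (R : realType) (J : set R)
    (f : R -> R[i]) : Prop :=
  forall l r : R, l <= r -> `[l, r]%classic `<=` J -> absolutely_continuous_on l r f.

(** * The differential expression [ell y = - y'' + q y] *)

(* [y] is differentiable on the interval [J] with derivative [dy], and [dy] is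
   locally absolutely continuous on [J] with almost everywhere derivative
   [ddy]. *)
Definition twice_differentiable (R : realType) (J : set R)
    (y dy ddy : R -> R[i]) : Prop :=
  [/\ forall x, J x -> has_derivative_in J y x (dy x),
      locally_absolutely_continuous J dy &
      {ae @lebesgue_measure R, forall x, J x -> has_derivative_in J dy x (ddy x)}].

Definition ell (R : realType) (q y ddy : R -> R[i]) (x : R) : R[i] :=
  - ddy x + q x * y x.

(* Carathéodory solutions of [(lam - ell) y = h] on [J]; [h = 0] gives
   [ell y = lam y]. *)
Definition ode_solution (R : realType) (J : set R) (q : R -> R[i]) (lam : R[i])
    (h y dy ddy : R -> R[i]) : Prop :=
  twice_differentiable J y dy ddy /\
  {ae @lebesgue_measure R, forall x, J x -> lam * y x - ell q y ddy x = h x}.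

(* In addition [y], [y'] and [ell y] are in [L^2(J)], the class in which the
   boundary value problem is posed. *)
Definition L2_ode_solution (R : realType) (J : set R) (q : R -> R[i]) (lam : R[i])
    (h y dy : R -> R[i]) : Prop :=
  exists ddy : R -> R[i],
    [/\ ode_solution J q lam h y dy ddy,
        square_integrable J y,
        square_integrable J dy &
        square_integrable J (ell q y ddy)].

(** * The coefficients of the transmission conditions *)

Definition mu_coef (R : realType) (N : nat) (eta xi : R) (c bb : 'I_N -> R)
    (lam : R[i]) : R[i] :=
  - (lam * eta%:C - xi%:C - \sum_(i < N) (bb i)%:C ^+ 2 / (lam - (c i)%:C)).

Definition nu_coef (R : realType) (M : nat) (kappa zeta : R) (d aa : 'I_M -> R)
    (lam : R[i]) : R[i] :=
  lam * kappa%:C + zeta%:C - \sum_(j < M) (aa j)%:C ^+ 2 / (lam - (d j)%:C).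

(* The poles of [mu_coef] (resp. [nu_coef]) are exactly the [c i] (resp. [d j]):
   the numbers [bb i] and [aa j] are positive and the [c i] (resp. [d j]) are
   distinct. *)
Definition is_pole (R : realType) (n : nat) (c : 'I_n -> R) (lam : R[i]) : Prop :=
  exists i : 'I_n, lam = (c i)%:C.

(** * The boundary value problem *)

(* Functions live on [[-a, 0[ `|` ]0, b]]: the values of [y] and [y'] at [-a] and
   [b] are those of the continuous extensions, the derivative there being
   one-sided. *)
Definition left_part (R : realType) (a : R) : set R := `[- a, 0[%classic.
Definition right_part (R : realType) (b : R) : set R := `]0, b]%classic.

Definition one_sided_limits (R : realType) (f : R -> R[i]) (fm fp : R[i]) : Prop :=
  (f x @[x --> 0^'-] --> (fm : R[i]^o)) /\ (f x @[x --> 0^'+] --> (fp : R[i]^o)).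

Definition transmission (R : realType) (N M : nat) (eta kappa xi zeta : R)
    (c bb : 'I_N -> R) (d aa : 'I_M -> R) (lam : R[i]) (y dy : R -> R[i]) : Prop :=
  exists ym yp dym dyp : R[i],
    [/\ one_sided_limits y ym yp,
        one_sided_limits dy dym dyp,
        (is_pole c lam -> yp = 0) /\
        (~ is_pole c lam -> yp * mu_coef eta xi c bb lam = dyp - dym) &
        (is_pole d lam -> dym = 0) /\
        (~ is_pole d lam -> dym * nu_coef kappa zeta d aa lam = yp - ym)].

(* [h = 0] is the homogeneous problem, whose non-zero solutions are the
   eigenfunctions. *)
Definition bvp_solution (R : realType) (a b : R) (q : R -> R[i]) (alpha beta : R)
    (N M : nat) (eta kappa xi zeta : R) (c bb : 'I_N -> R) (d aa : 'I_M -> R)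
    (lam : R[i]) (h y dy : R -> R[i]) : Prop :=
  [/\ L2_ode_solution (left_part a) q lam h y dy,
      L2_ode_solution (right_part b) q lam h y dy,
      y (- a) * (cos alpha)%:C = dy (- a) * (sin alpha)%:C,
      y b * (cos beta)%:C = dy b * (sin beta)%:C &
      transmission eta kappa xi zeta c bb d aa lam y dy].

Definition is_eigenvalue (R : realType) (a b : R) (q : R -> R[i]) (alpha beta : R)
    (N M : nat) (eta kappa xi zeta : R) (c bb : 'I_N -> R) (d aa : 'I_M -> R)
    (lam : R[i]) : Prop :=
  exists y dy : R -> R[i],
    bvp_solution a b q alpha beta eta kappa xi zeta c bb d aa lam (fun=> 0) y dy /\
    exists2 x, (left_part a `|` right_part b) x & y x != 0.

(** * The solutions [u] and [v] and the Green's function *)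

Definition vec2 (R : realType) (y dy : R[i]) : 'cV[R[i]]_2 :=
  \col_(i < 2) if i == 0 then y else dy.

Definition transfer_matrix (R : realType) (mu nu : R[i]) : 'M[R[i]]_2 :=
  \matrix_(i < 2, j < 2)
    if i == 0 then (if j == 0 then 1 else nu)
    else (if j == 0 then mu else 1 + mu * nu).

(* Solutions of [ell y = lam y] on both parts of the domain, coupled at 0 by
   the matrix [T]; [V (0^+) = T V (0^-)] and [V (0^-) = T^-1 V (0^+)] are the
   forms used for [u] and [v] respectively. *)
Definition is_u (R : realType) (a b : R) (q : R -> R[i]) (alpha : R)
    (T : 'M[R[i]]_2) (lam : R[i]) (u du : R -> R[i]) : Prop :=
  [/\ exists ddu, ode_solution (left_part a) q lam (fun=> 0) u du ddu,
      exists ddu, ode_solution (right_part b) q lam (fun=> 0) u du ddu,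
      u (- a) = (sin alpha)%:C /\ du (- a) = (cos alpha)%:C &
      exists um up dum dup : R[i],
        [/\ one_sided_limits u um up, one_sided_limits du dum dup &
            vec2 up dup = T *m vec2 um dum]].

Definition is_v (R : realType) (a b : R) (q : R -> R[i]) (beta : R)
    (T : 'M[R[i]]_2) (lam : R[i]) (v dv : R -> R[i]) : Prop :=
  [/\ exists ddv, ode_solution (left_part a) q lam (fun=> 0) v dv ddv,
      exists ddv, ode_solution (right_part b) q lam (fun=> 0) v dv ddv,
      v b = (sin beta)%:C /\ dv b = (cos beta)%:C &
      exists vm vp dvm dvp : R[i],
        [/\ one_sided_limits v vm vp, one_sided_limits dv dvm dvp &
            vec2 vm dvm = invmx T *m vec2 vp dvp]].

Definition wronskian (R : realType) (u du v dv : R -> R[i]) (x : R) : R[i] :=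
  u x * dv x - du x * v x.

(* Only meaningful for [x] and [t] in [[-a, 0[ `|` ]0, b]]; the values at [t = 0]
   and [t = x] do not affect integrals in [t]. *)
Definition green (R : realType) (u v : R -> R[i]) (psi : R[i]) (x t : R) : R[i] :=
  if x < t then u x * v t / psi
  else if t < x then u t * v x / psi
  else 0.

(* Main.v *)
Require Import Defs.
From HB Require Import structures.
From mathcomp Require Import all_boot all_order all_algebra.
From mathcomp Require Import complex.
From mathcomp Require Import all_classical all_reals all_analysis.
From mathcomp Require Import measurable_realfun ring lra.

Set Implicit Arguments.
Unset Strict Implicit.
Unset Printing Implicit Defensive.

Import Order.TTheory GRing.Theory Num.Theory.
Import numFieldNormedType.Exports.

Local Open Scope classical_set_scope.
Local Open Scope ring_scope.
Local Open Scope complex_scope.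
Import ComplexField.Normc.

(** The Green's function is variation of parameters. On each half of the
    interval, with [P x] the integral of [u h] from [-a] to [x] and [Q x] that
    of [v h] from [x] to [b], the function [g] is [(v P + u Q) / psi]. The terms
    containing [P' = u h] and [Q' = - v h] cancel in the first derivative, so
    [g' = (v' P + u' Q) / psi], and in the second they add up to
    [(u v' - u' v) h / psi = h]; hence [g'' = (q - lam) g + h].
    At [-a] one has [P = 0], so [(g, g')] is there a multiple of [(u, u')],
    and at [b] one has [Q = 0], so it is a multiple of [(v, v')]: the boundary
    conditions are inherited. Near 0 the coefficients [P] and [Q] are continuous, so [g] has
    the same transmission conditions as [u] and [v], these being linear.

    That [psi] is not zero uses the hypothesis on [lam]. The Wronskian is
    constant on each half, and its two values agree because the transfer matrix
    has determinant 1. If it vanished, evaluating it at [-a] would show that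
    [v] satisfies the boundary condition there, and [v] would be an
    eigenfunction: it is not identically zero, since the sine and cosine of
    [beta] do not vanish together ([wronskian_nonzero]).

    The difficulty is regularity: [h] is only square integrable, so [P], [Q],
    [u'], [v'] are absolutely continuous and everything above holds almost
    everywhere only. The tool that carries all the steps is the mean value
    inequality [ac_derivative_bound]: an absolutely continuous function whose
    derivative is at most [K] almost everywhere has increments at most [K] times
    the length. With [K = 0] it makes the Wronskian constant
    ([wronskian_constant]); applied to [f t - t f' x] it shows that an
    absolutely continuous function with a continuous almost everywhere
    derivative is differentiable everywhere ([ac_ae_derivative]), which is what
    turns the computation of [g'] into a statement about every point. The
    inequality itself comes from a covering argument ([covering_bound]): the
    exceptional null set lies in an open set of small measure, where absolute
    continuity controls the increments, and elsewhere the derivative does.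
    Conversely, that [P] and [Q] are absolutely continuous and have the expected
    derivatives almost everywhere is the absolute continuity of the integral
    and Lebesgue's differentiation theorem ([primitive_ac],
    [primitive_ae_derivative]). *)

(** * The modulus and limits of complex-valued functions *)
Section modulus.
Context {R : realType}.
Implicit Types z w : R[i].

Lemma norm_normc z : `|z| = (normc z)%:C.
Proof. by []. Qed.

Lemma normc_ge0 z : 0 <= normc z.
Proof. by case: z => x y; rewrite sqrtr_ge0. Qed.

Lemma ler_normcD z w : normc (z + w) <= normc z + normc w.
Proof. by rewrite -lecR rmorphD -!norm_normc; exact: ler_normD. Qed.

Lemma normc_oppE z : normc (- z) = normc z.
Proof. by apply: complexI; rewrite -!norm_normc normrN. Qed.

Lemma normc_dist z w : normc (z - w) = normc (w - z).
Proof. by rewrite -normc_oppE opprB. Qed.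

Lemma ler_normc_dist x z w : normc (z - w) <= normc (z - x) + normc (x - w).
Proof. by rewrite (_ : z - w = (z - x) + (x - w)) ?ler_normcD// addrA subrK. Qed.

Lemma normc_real (x : R) : normc x%:C = `|x|.
Proof. by rewrite /normc/= expr0n/= addr0 sqrtr_sqr. Qed.

Lemma Re_le_normc z : `|complex.Re z| <= normc z.
Proof. by rewrite -lecR; exact: normc_ge_Re. Qed.

Lemma Im_le_normc z : `|complex.Im z| <= normc z.
Proof.
by case: z => x y /=; rewrite -(sqrtr_sqr y) ler_wsqrtr// lerDr sqr_ge0.
Qed.

Lemma complex_ReD z w : complex.Re (z + w) = complex.Re z + complex.Re w.
Proof. by case: z w => ? ? [? ?]. Qed.

Lemma complex_ImD z w : complex.Im (z + w) = complex.Im z + complex.Im w.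
Proof. by case: z w => ? ? [? ?]. Qed.

Lemma complex_ReN z : complex.Re (- z) = - complex.Re z.
Proof. by case: z. Qed.

Lemma complex_ImN z : complex.Im (- z) = - complex.Im z.
Proof. by case: z. Qed.

Lemma complex_ReM z w : complex.Re (z * w) =
  complex.Re z * complex.Re w - complex.Im z * complex.Im w.
Proof. by case: z w => ? ? [? ?]. Qed.

Lemma complex_ImM z w : complex.Im (z * w) =
  complex.Re z * complex.Im w + complex.Im z * complex.Re w.
Proof. by case: z w => ? ? [? ?]. Qed.

Lemma normc_le_ReIm z : normc z <= `|complex.Re z| + `|complex.Im z|.
Proof.
case: z => x y /=.
rewrite -[leRHS]ger0_norm ?addr_ge0// -[leRHS]sqrtr_sqr ler_wsqrtr//.
rewrite sqrrD !real_normK ?num_real// lerD2r lerDl.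
by rewrite mulrn_wge0// mulr_ge0.
Qed.

Lemma normc_sqr z : normc z ^+ 2 = complex.Re z ^+ 2 + complex.Im z ^+ 2.
Proof. by case: z => x y /=; rewrite sqr_sqrtr// addr_ge0 ?sqr_ge0. Qed.

Lemma normc_le_eps_eq0 z : (forall e : R, 0 < e -> normc z <= e) -> z = 0.
Proof.
move=> h; apply: eq0_normc; apply/eqP; rewrite eq_le normc_ge0 andbT.
by apply/ler_addgt0Pl => e e0; rewrite addr0; exact: h.
Qed.

(** Convergence in [R[i]] is tested with positive elements of [R[i]], which are
    real; this form replaces them, and the modulus, by elements of [R]. *)
Lemma cvgC_normP T (F : set_system T) {FF : Filter F} (f : T -> R[i]) (l : R[i]) :
  (f x @[x --> F] --> (l : R[i]^o)) <->
  (forall e : R, 0 < e -> \forall x \near F, normc (f x - l) < e).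
Proof.
have E := @cvgrPdist_lt R[i] R[i]^o T F FF f l.
split => [/E fl e e0|fl].
  have e0' : 0 < e%:C by rewrite ltcR.
  by apply: filterS (fl _ e0') => x; rewrite distrC norm_normc ltcR.
apply/E => -[e1 e2]; rewrite ltcE/= => /andP[/eqP e20 e10].
by apply: filterS (fl _ e10) => x; rewrite e20 distrC norm_normc ltcR.
Qed.

Lemma eq_cvgC T (F : set_system T) (f g : T -> R[i]) (l : R[i]) : f =1 g ->
  f x @[x --> F] --> (l : R[i]^o) -> g x @[x --> F] --> (l : R[i]^o).
Proof. by move=> /funext ->. Qed.

Lemma cvgCD T (F : set_system T) {FF : Filter F} (f g : T -> R[i]) (a b : R[i]) :
  f x @[x --> F] --> (a : R[i]^o) -> g x @[x --> F] --> (b : R[i]^o) ->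
  (f x + g x) @[x --> F] --> (a + b : R[i]^o).
Proof. exact: (@cvgD R[i] R[i]^o T F FF f g a b). Qed.

Lemma cvgCM T (F : set_system T) {FF : Filter F} (f g : T -> R[i]) (a b : R[i]) :
  f x @[x --> F] --> (a : R[i]^o) -> g x @[x --> F] --> (b : R[i]^o) ->
  (f x * g x) @[x --> F] --> (a * b : R[i]^o).
Proof. exact: (@cvgM R[i] T F FF f g a b). Qed.

Lemma cvgC_const T (F : set_system T) {FF : ProperFilter F} (f : T -> R[i]) (c l : R[i]) :
  (\forall x \near F, f x = c) -> f x @[x --> F] --> (l : R[i]^o) -> c = l.
Proof.
move=> fc /cvgC_normP fl; apply/eqP; rewrite -subr_eq0; apply/eqP/normc_le_eps_eq0 => e e0.
have [x [xc xl]] := filter_ex (filterI fc (fl _ e0)).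
by rewrite -xc; exact: ltW.
Qed.

Lemma cvgCN T (F : set_system T) {FF : Filter F} (f : T -> R[i]) (a : R[i]) :
  f x @[x --> F] --> (a : R[i]^o) -> (- f x) @[x --> F] --> (- a : R[i]^o).
Proof. exact: (@cvgN R[i] R[i]^o T F FF f a). Qed.

End modulus.

(** * Covering an interval by good and bad pieces *)
Section covering.
Context {R : realType}.
Local Notation mu := (@lebesgue_measure R).

(** Compactness of a segment as an induction principle: the supremum of the
    points that satisfy [Q] can be passed, because near it [Q] propagates from
    the left to the right. *)
Lemma real_induction (l r : R) (Q : R -> Prop) : l <= r -> Q l ->
  (forall c, l <= c <= r -> exists2 d, 0 < d &
     forall x z, l <= x -> x <= c -> c <= z -> z <= r ->
       c - d < x -> z < c + d -> Q x -> Q z) ->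
  Q r.
Proof.
move=> lr Ql Qloc; pose S := [set x | l <= x <= r /\ Q x].
have Sl : S l by split=> //; rewrite lexx.
have Sub : ubound S r by move=> x [/andP[]].
have hS : has_sup S by split; [exists l|exists r].
have lS : l <= sup S <= r.
  by apply/andP; split; [apply: ub_le_sup => //; exists r|apply: ge_sup => //; exists l].
have [d d0 dQ] := Qloc _ lS.
have [x [/andP[lx xr] Qx] dx] := sup_adherent d0 hS.
have xS : x <= sup S by apply: ub_le_sup; [exists r|split=> //; rewrite lx].
have [/andP[lS' Sr]] := (lS, tt).
have Sz z : sup S <= z -> z <= r -> z < sup S + d -> S z.
  move=> Sz zr zd; split; first by rewrite (le_trans lS').
  exact: (dQ x).
suff -> : r = sup S by have [] := Sz _ (lexx _) Sr; rewrite ?ltrDl.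
apply/eqP; rewrite eq_le Sr andbT leNgt; apply/negP => ltSr.
(* A point beyond the supremum, close enough for [Qloc] to apply. *)
have [m [m1 m2 m3]] : exists m, [/\ sup S < m, m <= r & m < sup S + d].
  exists (Num.min r (sup S + d / 2)).
  have d2 : 0 < d / 2 by rewrite divr_gt0.
  have d2d : d / 2 < d by lra.
  by split; [rewrite lt_min ltSr ltrDl|rewrite ge_min lexx|
    rewrite gt_min ltrD2l d2d orbT].
have : m <= sup S by apply: ub_le_sup; [exists r|apply: Sz => //; exact: ltW].
by rewrite leNgt m1.
Qed.

(** Walking from [l] to [r], a step around a point outside [U] costs at most
    [K] times its length, and a step around a point of [U] can be taken inside
    [U]; the latter steps are recorded as the intervals [[s i, t i]]. Being
    disjoint and contained in [U] they have total length at most [mu U]. An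
    empty [U] gives an everywhere version, a [U] of small measure an almost
    everywhere version of the mean value inequality. *)
Lemma covering_bound (l r : R) (f : R -> R[i]) (K : R) (U : set R) :
  0 <= K -> l <= r -> open U ->
  (forall x, l <= x <= r -> ~ U x -> exists2 d, 0 < d &
     forall z, l <= z <= r -> `|z - x| < d -> normc (f z - f x) <= K * `|z - x|) ->
  exists n (s t : nat -> R),
    [/\ forall i, (i < n)%N -> [/\ l <= s i, s i <= t i, t i <= r & U (s i)],
        forall i j, (i < j)%N -> (j < n)%N -> t i <= s j,
        ((\sum_(i < n) (t i - s i))%:E <= mu U)%E &
        normc (f r - f l) <= K * (r - l) + \sum_(i < n) normc (f (t i) - f (s i))].
Proof.
move=> K0 lr oU fU; have mU : measurable U by exact: open_measurable.
(* The lengths are compared with the part of U already passed. *)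
pose Q x := exists n (s t : nat -> R),
    [/\ forall i, (i < n)%N -> [/\ l <= s i, s i <= t i, t i <= x & U (s i)],
        forall i j, (i < j)%N -> (j < n)%N -> t i <= s j,
        ((\sum_(i < n) (t i - s i))%:E <= mu (U `&` `[l, x[))%E &
        normc (f x - f l) <= K * (x - l) + \sum_(i < n) normc (f (t i) - f (s i))].
suff [n [s [t [h1 h2 h3 h4]]]] : Q r.
  exists n, s, t; split => //; apply: (le_trans h3).
  by apply: le_measure; rewrite ?inE//; apply: measurableI.
apply: (real_induction lr).
  exists 0%N, (fun=> l), (fun=> l).
  by split=> //; rewrite big_ord0 ?measure_ge0// !subrr mulr0 addr0 normc0.
move=> c lcr; have [/andP[lc cr]] := (lcr, tt).
have [Uc|nUc] := pselect (U c).
- have /nbhs_ballP[d d0 dU] : nbhs c U by rewrite nbhsE; exists U.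
  exists d => // x z lx xc cz zr dx zd [n [s [t [h1 h2 h3 h4]]]].
  have xz : x <= z by exact: le_trans cz.
  have xzU : `[x, z[ `<=` U.
    move=> y /=; rewrite in_itv/= => /andP[xy yz]; apply: dU.
    rewrite /ball/= ltr_distlC; apply/andP; split; first exact: lt_le_trans xy.
    exact: lt_trans zd.
  exists n.+1, (fun k => if k == n then x else s k),
    (fun k => if k == n then z else t k); split.
  + move=> i; rewrite ltnS leq_eqVlt; case: eqP => [_ _|_/= /h1[]].
      by split=> //; apply: dU; rewrite /ball/= ltr_distlC dx (le_lt_trans _ zd).
    by move=> ? ? ? ?; split => //; exact: le_trans xz.
  + move=> i j ij; rewrite ltnS => jn.
    have iN : (i == n) = false by apply/eqP => iE; move: ij; rewrite ltnNge iE jn.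
    rewrite iN; case: eqP => [jE|/eqP jN]; last by apply: h2; rewrite // ltn_neqAle jN.
    by have [] := h1 i; rewrite ?jE// -jE.
  + rewrite big_ord_recr/= eqxx EFinD.
    under eq_bigr do rewrite (ltn_eqF (ltn_ord _)).
    have -> : (z - x)%:E = mu `[x, z[.
      rewrite lebesgue_measure_itv/= lte_fin; case: ltP => // zx.
      by rewrite (_ : z = x) ?subrr//; apply/eqP; rewrite eq_le zx xz.
    apply: (le_trans (leeD2r _ h3)); rewrite -measureU//; last 2 first.
      exact: measurableI.
      rewrite -subset0 => y [[_ /=]]; rewrite !in_itv/= => /andP[_ yx] /andP[xy _].
      by move: yx; rewrite ltNge xy.
    apply: le_measure; rewrite ?inE; [by apply: measurableU => //; apply: measurableI|
      by apply: measurableI|].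
    move=> y [[Uy]|/[dup] /xzU Uy] /=; rewrite !in_itv/= => /andP[y1 y2]; split => //=.
      by rewrite y1 (lt_le_trans y2).
    by rewrite y2 (le_trans lx).
  + rewrite big_ord_recr/= eqxx.
    under eq_bigr do rewrite (ltn_eqF (ltn_ord _)).
    rewrite addrA [leRHS]addrC; apply: (le_trans (ler_normc_dist (f x) _ _)).
    rewrite lerD2l; apply: (le_trans h4); rewrite lerD2r.
    by rewrite ler_wpM2l// lerD2r.
- have [d d0 fd] := fU _ lcr nUc.
  exists d => // x z lx xc cz zr dx zd [n [s [t [h1 h2 h3 h4]]]].
  have xz : x <= z by exact: le_trans cz.
  exists n, s, t; split => //.
  + move=> i /h1[? ? ? ?]; split => //; exact: le_trans xz.
  + apply: (le_trans h3); apply: le_measure; rewrite ?inE; try exact: measurableI.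
    apply: setIS => y /=; rewrite !in_itv/= => /andP[-> y2].
    exact: lt_le_trans xz.
  + have H1 : normc (f z - f c) <= K * (z - c).
      have := fd z; rewrite (le_trans lc cz) zr ger0_norm ?subr_ge0//; apply=> //.
      by rewrite ltrBlDl.
    have H2 : normc (f c - f x) <= K * (c - x).
      have := fd x; rewrite lx (le_trans xc cr) distrC ger0_norm ?subr_ge0// normc_dist.
      by apply=> //; rewrite ltrBlDl -ltrBlDr.
    have := ler_normc_dist (f c) (f z) (f x).
    have := ler_normc_dist (f x) (f z) (f l).
    have -> : K * (z - l) = K * (z - c) + K * (c - x) + K * (x - l) by ring.
    lra.
Qed.

End covering.

(** * The mean value inequality *)
Section differentiation.
Context {R : realType}.
Local Notation mu := (@lebesgue_measure R).
Implicit Types (J : set R) (f g : R -> R[i]).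

Definition continuous_in J f x := f z @[z --> within J (nbhs x)] --> (f x : R[i]^o).

Lemma cvg_withinP J (x : R) f (l : R[i]) :
  (f z @[z --> within J (nbhs x)] --> (l : R[i]^o)) <->
  (forall e, 0 < e -> exists2 d, 0 < d &
    forall z, J z -> `|z - x| < d -> normc (f z - l) <= e).
Proof.
split=> [/cvgC_normP h e e0|h].
  have /nbhs_ballP[d /= d0 hd] := h _ e0.
  exists d => // z Jz zd; apply: ltW; apply: hd => //.
  by rewrite /ball/= distrC.
apply/cvgC_normP => e e0.
have e2 : 0 < e / 2 by rewrite divr_gt0.
have [d d0 hd] := h _ e2.
apply/nbhs_ballP; exists d => //= z /=; rewrite /ball/= distrC => zd Jz.
by apply: (le_lt_trans (hd _ Jz zd)); lra.
Qed.

(** The multiplied-out form has no quotient, so [z = x] needs no exception. *)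
Lemma has_derivative_inP J f x d :
  has_derivative_in J f x d <->
  (forall e, 0 < e -> exists2 r, 0 < r & forall z, J z -> `|z - x| < r ->
    normc (f z - f x - (z - x)%:C * d) <= e * `|z - x|).
Proof.
have key z : z != x -> normc (f z - f x - (z - x)%:C * d) =
    `|z - x| * normc (((z - x)^-1)%:C * (f z - f x) - d).
  move=> zx; rewrite -normc_real -normcM mulrBr mulrA -rmorphM/=.
  by rewrite mulfV ?subr_eq0// rmorph1 mul1r.
split=> [/cvgC_normP h e e0|h].
  have /nbhs_ballP[r /= r0 hr] := h _ e0.
  exists r => // z Jz zr; have [->|zx] := eqVneq z x.
    by rewrite !subrr mul0r subrr normc0 normr0 mulr0.
  rewrite key// mulrC ler_wpM2r// ltW//; apply: hr => //.
  by rewrite /ball/= distrC.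
apply/cvgC_normP => e e0.
have e2 : 0 < e / 2 by rewrite divr_gt0.
have [r r0 hr] := h _ e2.
apply/nbhs_ballP; exists r => //= z /=; rewrite /ball/= distrC => zr zx Jz.
have := hr _ Jz zr; rewrite key// mulrC ler_pM2r ?normr_gt0 ?subr_eq0//.
by move=> /le_lt_trans; apply; lra.
Qed.

Lemma has_derivative_in_sub J J' f x d : J' `<=` J ->
  has_derivative_in J f x d -> has_derivative_in J' f x d.
Proof.
move=> sJ /has_derivative_inP h; apply/has_derivative_inP => e /h[r r0 hr].
by exists r => // z /sJ; exact: hr.
Qed.

Lemma has_derivative_in_le J f x d e : has_derivative_in J f x d -> 0 < e ->
  exists2 r, 0 < r & forall z, J z -> `|z - x| < r ->
    normc (f z - f x) <= (normc d + e) * `|z - x|.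
Proof.
move=> /has_derivative_inP h /h[r r0 hr]; exists r => // z Jz zr.
have := hr _ Jz zr.
have := ler_normcD (f z - f x - (z - x)%:C * d) ((z - x)%:C * d).
rewrite subrK normcM normc_real mulrDl [`|_| * _]mulrC; lra.
Qed.

Lemma has_derivative_in_continuous J f x d :
  has_derivative_in J f x d -> continuous_in J f x.
Proof.
move=> /has_derivative_in_le/(_ ltr01)[r r0 hr]; apply/cvg_withinP => e e0.
have K0 : 0 < normc d + 1 by rewrite ltr_wpDl ?normc_ge0.
exists (Num.min r (e / (normc d + 1))); first by rewrite lt_min r0 divr_gt0.
move=> z Jz; rewrite lt_min => /andP[zr ze]; apply: (le_trans (hr _ Jz zr)).
by rewrite mulrC -ler_pdivlMr// ltW.
Qed.

(** The mean value inequality for complex-valued functions, where the mean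
    value theorem fails. *)
Lemma derivative_bound l r f K : 0 <= K -> l <= r ->
  (forall x, l <= x <= r ->
     exists2 d, has_derivative_in `[l, r] f x d & normc d <= K) ->
  normc (f r - f l) <= K * (r - l).
Proof.
move=> K0 lr fd; apply/ler_addgt0Pr => e e0.
pose e' := e / (r - l + 1).
have rl1 : 0 < r - l + 1 by lra.
have e'0 : 0 < e' by rewrite divr_gt0.
have Ke' : 0 <= K + e' by lra.
have loc x : l <= x <= r -> ~ set0 x -> exists2 p, 0 < p & forall z, l <= z <= r ->
    `|z - x| < p -> normc (f z - f x) <= (K + e') * `|z - x|.
  move=> xlr _; have [d dx dK] := fd _ xlr.
  have [p p0 hp] := has_derivative_in_le dx e'0.
  exists p => // z zlr zp; apply: (le_trans (hp _ _ zp)) => //=.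
  by rewrite ler_wpM2r// lerD2r.
have [n [s [t [h _ _ le_f]]]] := covering_bound Ke' lr open0 loc.
have n0 : n = 0%N by case: n h {le_f} => // n /(_ 0%N erefl)[].
move: le_f; rewrite n0 big_ord0 addr0 => /le_trans; apply.
rewrite mulrDl lerD2l /e' mulrAC ler_pdivrMr// ler_wpM2l ?ltW//; lra.
Qed.

(** Absolute continuity makes a null set of bad points harmless: cover it by
    an open set so small that the increments over disjoint intervals in it sum
    up to less than any prescribed number. *)
Lemma ac_derivative_bound l r f K : 0 <= K -> l <= r ->
  absolutely_continuous_on l r f ->
  {ae mu, forall x, l <= x <= r ->
     exists2 d, has_derivative_in `[l, r] f x d & normc d <= K} ->
  normc (f r - f l) <= K * (r - l).
Proof.
move=> K0 lr acf [N [mN N0 hN]]; apply/ler_addgt0Pr => e e0.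
pose e' := e / (r - l + 1).
have rl1 : 0 < r - l + 1 by lra.
have e'0 : 0 < e' by rewrite divr_gt0.
have Ke' : 0 <= K + e' by lra.
have [p p0 hp] := acf _ e'0.
have [|U [oU NU muU]] := lebesgue_regularity_outer mN _ p0.
  by rewrite [X in (X < _)%E]N0 ltry.
have mU : measurable U by exact: open_measurable.
have Up : (mu U < p%:E)%E.
  rewrite -(setDUK NU) measureU//; [|exact: measurableD|by rewrite setDIK].
  by rewrite [X in (X + _)%E]N0 add0e.
have loc x : l <= x <= r -> ~ U x -> exists2 p, 0 < p & forall z, l <= z <= r ->
    `|z - x| < p -> normc (f z - f x) <= (K + e') * `|z - x|.
  move=> xlr nUx; have [d dx dK] : exists2 d, has_derivative_in `[l, r] f x d & normc d <= K.
    by apply: contrapT => nd; apply: nUx; apply: NU; apply: hN => /= /(_ xlr).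
  have [q q0 hq] := has_derivative_in_le dx e'0.
  exists q => // z zlr zq; apply: (le_trans (hq _ _ zq)) => //=.
  by rewrite ler_wpM2r// lerD2r.
have [n [s [t [h1 h2 h3 h4]]]] := covering_bound Ke' lr oU loc.
have h5 : \sum_(i < n) normc (f (t i) - f (s i)) < e'.
  rewrite -ltcR rmorph_sum/=.
  apply: (hp n (fun i => s i) (fun i => t i)).
  - by move=> i; have [] := h1 i (ltn_ord i).
  - by move=> i j ij; apply: h2.
  - by rewrite -lte_fin; exact: le_lt_trans h3 Up.
apply: (le_trans h4); rewrite mulrDl.
have -> : e = e' * (r - l) + e' by rewrite /e'; field; rewrite gt_eqF.
lra.
Qed.
End differentiation.

(** * Calculus of derivatives and of absolutely continuous functions *)
Section algebra.
Context {R : realType}.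
Local Notation mu := (@lebesgue_measure R).
Implicit Types (J : set R) (f g : R -> R[i]).

Lemma has_derivative_in_cst J (k : R[i]) x : has_derivative_in J (fun=> k) x 0.
Proof.
apply/has_derivative_inP => e e0; exists 1 => // z _ _.
by rewrite mulr0 !subrr normc0 mulr_ge0// ltW.
Qed.

Lemma has_derivative_in_id J x : has_derivative_in J (fun z => z%:C) x 1.
Proof.
apply/has_derivative_inP => e e0; exists 1 => // z _ _.
by rewrite mulr1 rmorphB subrr normc0 mulr_ge0// ltW.
Qed.

Lemma has_derivative_inD J f g x a b :
  has_derivative_in J f x a -> has_derivative_in J g x b ->
  has_derivative_in J (fun z => f z + g z) x (a + b).
Proof.
move=> fa gb; apply: eq_cvgC (cvgCD fa gb) => z; ring.
Qed.

Lemma has_derivative_inM J f g x a b :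
  has_derivative_in J f x a -> has_derivative_in J g x b ->
  has_derivative_in J (fun z => f z * g z) x (a * g x + f x * b).
Proof.
move=> fa gb.
have gc : g z @[z --> within J x^'] --> (g x : R[i]^o).
  move=> A /(has_derivative_in_continuous gb).
  by apply: (@filterS _ (nbhs x)) => z h _ Jz; exact: h.
have fc : (fun=> f x) z @[z --> within J x^'] --> (f x : R[i]^o) by exact: (@cvg_cst R[i]^o).
apply: eq_cvgC (cvgCD (cvgCM fa gc) (cvgCM fc gb)) => z; ring.
Qed.

Lemma absolutely_continuous_onP l r f : absolutely_continuous_on l r f <->
  forall e : R, 0 < e -> exists2 d : R, 0 < d &
    forall (n : nat) (s t : 'I_n -> R),
      (forall i, l <= s i /\ s i <= t i /\ t i <= r) ->
      (forall i j : 'I_n, (i < j)%N -> t i <= s j) ->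
      \sum_(i < n) (t i - s i) < d ->
      \sum_(i < n) normc (f (t i) - f (s i)) < e.
Proof.
by split=> h e /h[d d0 hd]; exists d => // n s t h1 h2 h3; have := hd n s t h1 h2 h3;
  rewrite -ltcR rmorph_sum.
Qed.

Lemma ac_uniform l r f : absolutely_continuous_on l r f -> forall e, 0 < e ->
  exists2 d, 0 < d & forall x z, l <= x <= r -> l <= z <= r -> `|z - x| < d ->
    normc (f z - f x) <= e.
Proof.
move=> /absolutely_continuous_onP h e /h[d d0 hd]; exists d => //.
suff H x z : l <= x <= r -> l <= z <= r -> x <= z -> z - x < d -> normc (f z - f x) <= e.
  move=> x z xlr zlr; have [xz|/ltW zx] := leP x z.
    by rewrite ger0_norm ?subr_ge0//; exact: H.
  by rewrite distrC ger0_norm ?subr_ge0// normc_dist; exact: H.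
move=> /andP[lx xr] /andP[lz zr] xz zxd; apply: ltW.
have := hd 1%N (fun=> x) (fun=> z); rewrite !big_ord1; apply=> //.
by move=> i j; rewrite !ord1.
Qed.

(** Sums, multiples and products all have increments controlled by those
    of their two components. *)
Lemma ac_dominated l r f g F K : 0 <= K ->
  absolutely_continuous_on l r f -> absolutely_continuous_on l r g ->
  (forall x y, l <= x -> x <= y -> y <= r ->
    normc (F y - F x) <= K * (normc (f y - f x) + normc (g y - g x))) ->
  absolutely_continuous_on l r F.
Proof.
move=> K0 /absolutely_continuous_onP fac /absolutely_continuous_onP gac FK; apply/absolutely_continuous_onP => e e0.
have e'0 : 0 < e / (2 * (K + 1)) by rewrite divr_gt0//; lra.
have [d d0 hd] := fac _ e'0; have [p p0 hp] := gac _ e'0.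
exists (Num.min d p); first by rewrite lt_min d0.
move=> n s t h1 h2; rewrite lt_min => /andP[h3 h4].
have A := hd _ _ _ h1 h2 h3; have B := hp _ _ _ h1 h2 h4.
apply: (@le_lt_trans _ _ (K * (\sum_(i < n) normc (f (t i) - f (s i)) +
    \sum_(i < n) normc (g (t i) - g (s i))))).
  rewrite -big_split mulr_sumr/=; apply: ler_sum => i _.
  by have [? [? ?]] := h1 i; exact: FK.
(* Each of the two sums is below e / (2 (K + 1)), and K < K + 1. *)
apply: (@le_lt_trans _ _ (K * (2 * (e / (2 * (K + 1)))))).
  by rewrite ler_wpM2l//; lra.
have -> : K * (2 * (e / (2 * (K + 1)))) = e * (K / (K + 1)).
  by field; rewrite gt_eqF//; lra.
by rewrite gtr_pMr// ltr_pdivrMr; lra.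
Qed.

Lemma lipschitz_ac l r f K : 0 <= K ->
  (forall x y, l <= x -> x <= y -> y <= r -> normc (f y - f x) <= K * (y - x)) ->
  absolutely_continuous_on l r f.
Proof.
move=> K0 fK; apply/absolutely_continuous_onP => e e0.
have K1 : 0 < K + 1 by lra.
exists (e / (K + 1)); first by rewrite divr_gt0.
move=> n s t h1 h2; rewrite ltr_pdivlMr// => h3; apply: le_lt_trans h3.
rewrite mulr_suml; apply: ler_sum => i _; have [? [? ?]] := h1 i.
apply: (le_trans (fK _ _ _ _ _)) => //; rewrite mulrC ler_wpM2l ?subr_ge0//; lra.
Qed.

Lemma acD l r f g :
  absolutely_continuous_on l r f -> absolutely_continuous_on l r g ->
  absolutely_continuous_on l r (fun x => f x + g x).
Proof.
move=> fac gac; apply: (ac_dominated ler01 fac gac) => x y _ _ _.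
by rewrite mul1r opprD addrACA ler_normcD.
Qed.

Lemma ac_bounded l r f : l <= r -> absolutely_continuous_on l r f ->
  exists2 K, 0 <= K & forall x, l <= x <= r -> normc (f x) <= K.
Proof.
move=> lr fac; have [d d0 hd] := ac_uniform fac ltr01.
suff [K hK] : exists K, forall x, l <= x <= r -> normc (f x) <= K.
  exists K => //; apply: le_trans (hK l _); rewrite ?normc_ge0// lexx//.
apply: (real_induction (Q := fun y => exists K, forall x, l <= x <= y -> normc (f x) <= K) lr).
  exists (normc (f l)) => x /andP[lx xl].
  by rewrite (_ : x = l)//; apply/eqP; rewrite eq_le lx xl.
move=> c /andP[lc cr]; exists d => // x z lx xc cz zr dx zd [K hK].
exists (Num.max K (normc (f c) + 1)) => y /andP[ly yz].
rewrite le_max; have [yx|xy] := leP y x; first by rewrite hK ?ly.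
apply/orP; right; have := hd c y.
rewrite lc cr ly (le_trans yz zr) => /(_ isT isT).
have -> : `|y - c| < d by rewrite ltr_distlC; apply/andP; lra.
move=> /(_ isT); have := ler_normcD (f y - f c) (f c); rewrite subrK; lra.
Qed.

Lemma acM l r f g : l <= r ->
  absolutely_continuous_on l r f -> absolutely_continuous_on l r g ->
  absolutely_continuous_on l r (fun x => f x * g x).
Proof.
move=> lr fac gac; have [Kf Kf0 fK] := ac_bounded lr fac.
have [Kg Kg0 gK] := ac_bounded lr gac.
have K0 : 0 <= Kf + Kg by exact: addr_ge0.
apply: (ac_dominated K0 fac gac) => x y lx xy yr.
have -> : f y * g y - f x * g x = f y * (g y - g x) + (f y - f x) * g x by ring.
apply: (le_trans (ler_normcD _ _)); rewrite !normcM.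
have A := fK y; rewrite (le_trans lx xy) yr in A; have {}A := A isT.
have B := gK x; rewrite lx (le_trans xy yr) in B; have {}B := B isT.
have P := normc_ge0 (f y - f x); have Q := normc_ge0 (g y - g x).
have := normc_ge0 (f y); have := normc_ge0 (g x); nra.
Qed.

Lemma ac_continuous_in l r f x : absolutely_continuous_on l r f -> l <= x <= r ->
  continuous_in `[l, r] f x.
Proof.
move=> fac xlr; apply/cvg_withinP => e e0; have [d d0 hd] := ac_uniform fac e0.
by exists d => // z zlr zd; apply: hd.
Qed.

End algebra.

(** * Functions on one side of the origin *)
Section intervals.
Context {R : realType}.
Local Notation mu := (@lebesgue_measure R).
Implicit Types (J : set R) (f g : R -> R[i]).

Lemma ae_imply (P Q : R -> Prop) : (forall x, P x -> Q x) ->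
  {ae mu, forall x, P x} -> {ae mu, forall x, Q x}.
Proof. by move=> PQ; apply: filterS => //; exact: (ae_filter_ringOfSetsType mu). Qed.

Lemma ae_imply2 (P Q S : R -> Prop) : (forall x, P x -> Q x -> S x) ->
  {ae mu, forall x, P x} -> {ae mu, forall x, Q x} -> {ae mu, forall x, S x}.
Proof. by move=> PQ; apply: filterS2 => //; exact: (ae_filter_ringOfSetsType mu). Qed.

Lemma ae_neq (c : R) : {ae mu, forall x : R, x != c}.
Proof.
exists [set c]; split; [exact: measurable_set1|exact: lebesgue_measure_set1|].
by move=> x /= /negP; rewrite negbK => /eqP.
Qed.

Lemma interval_segment J x y : is_interval J -> J x -> J y -> `[x, y] `<=` J.
Proof. by move=> iJ Jx Jy z /=; rewrite in_itv/=; exact: iJ. Qed.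

Lemma ac_cst l r (k : R[i]) : absolutely_continuous_on l r (fun=> k).
Proof.
by apply: (lipschitz_ac (lexx 0)) => x y _ _ _; rewrite subrr normc0 mul0r.
Qed.

Lemma ac_id (l r : R) : absolutely_continuous_on l r (fun x => x%:C).
Proof.
apply: (lipschitz_ac ler01) => x y _ xy _.
by rewrite -rmorphB normc_real ger0_norm ?subr_ge0// mul1r.
Qed.

(** A derivative that is continuous on a segment is bounded there. *)
Lemma derivative_ac l r f df : l <= r ->
  (forall x, l <= x <= r -> has_derivative_in `[l, r] f x (df x)) ->
  absolutely_continuous_on l r df -> absolutely_continuous_on l r f.
Proof.
move=> lr fd dfac; have [K K0 hK] := ac_bounded lr dfac.
apply: (lipschitz_ac K0) => x y lx xy yr; apply: derivative_bound => // z /andP[xz zy].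
have zlr : l <= z <= r by rewrite (le_trans lx xz) (le_trans zy yr).
exists (df z); last exact: hK.
by apply: has_derivative_in_sub (fd _ zlr); apply: subset_itv; rewrite bnd_simp.
Qed.

(** Between [x] and [z] the function [f t - t df(x)] has the derivative
    [df t - df x] almost everywhere, and this is small by continuity of [df]; so
    its increment is small compared with [z - x]. *)
Lemma ac_ae_derivative J f df x : is_interval J ->
  locally_absolutely_continuous J f ->
  {ae mu, forall x, J x -> has_derivative_in J f x (df x)} ->
  J x -> continuous_in J df x -> has_derivative_in J f x (df x).
Proof.
move=> iJ fac fd Jx dfc; apply/has_derivative_inP => e e0.
have [d d0 hd] := (cvg_withinP _ _ _ _).1 dfc _ e0; exists d => //.
(* The function f minus its tangent at x; its derivative is small on [l, r]. *)
have key l r : J l -> J r -> l <= r ->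
    (forall t, l <= t <= r -> `|t - x| < d) ->
    normc (f r - f l - (r - l)%:C * df x) <= e * (r - l).
  move=> Jl Jr lr ltd; pose F t := f t + t%:C * - df x.
  have sJ := interval_segment iJ Jl Jr.
  have -> : f r - f l - (r - l)%:C * df x = F r - F l by rewrite /F rmorphB; ring.
  apply: (ac_derivative_bound (ltW e0) lr).
    apply: acD; first exact: fac.
    by apply: acM => //; [exact: ac_id|exact: ac_cst].
  apply: ae_imply fd => t ft /[dup] ltr_ /andP[lt tr].
  have Jt : J t by apply: sJ; rewrite /= in_itv/= lt.
  exists (df t + (1 * - df x + t%:C * 0)); last first.
    by rewrite mulr0 addr0 mul1r; apply: hd => //; exact: ltd.
  apply: has_derivative_inD; first exact: has_derivative_in_sub (ft Jt).
  by apply: has_derivative_inM; [exact: has_derivative_in_id|exact: has_derivative_in_cst].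
move=> z Jz zd; have [xz|/ltW zx] := leP x z.
  rewrite ger0_norm ?subr_ge0//; apply: key => // t /andP[xt tz].
  by move: zd; rewrite !ger0_norm ?subr_ge0//; lra.
have -> : f z - f x - (z - x)%:C * df x = - (f x - f z - (x - z)%:C * df x).
  by rewrite !rmorphB; ring.
rewrite normc_oppE distrC ger0_norm ?subr_ge0//; apply: key => // t /andP[zt tx].
by move: zd; rewrite distrC (distrC t) !ger0_norm ?subr_ge0//; lra.
Qed.

(** What the proofs need to know of [[-a, 0[] and of []0, b]], so that both are
    handled at once: an interval that becomes a segment by adding 0, each of
    whose points has a compact neighbourhood in it. *)
Record one_side J : Prop := OneSide {
  one_side_itv : is_interval J;
  one_side_measurable : measurable J;
  one_side_segment : forall x, J x -> exists l r d, [/\ 0 < d, l <= x <= r,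
    `[l, r] `<=` J & forall z, J z -> `|z - x| < d -> l <= z <= r];
  one_side_closure : exists l r, [/\ l <= r, J `<=` `[l, r] &
    forall c, l <= c <= r -> J c \/ c = 0];
  one_side_proper : ProperFilter (within J (nbhs (0:R))) }.

Lemma left_part_one_side (a : R) : 0 < a -> one_side (left_part a).
Proof.
move=> a0; split.
- exact: interval_is_interval.
- exact: measurable_itv.
- move=> x; rewrite /left_part/= in_itv/= => /andP[ax x0].
  exists (- a), (x / 2), (- x / 2); split; [lra|apply/andP; lra| |].
    by apply: subset_itvl; rewrite bnd_simp; lra.
  by move=> z; rewrite /left_part/= in_itv/= ltr_distl => /andP[-> _] /andP[_]/=; lra.
- exists (- a), 0; split; [lra|by apply: subset_itvl; rewrite bnd_simp|].
  move=> c /andP[ac]; rewrite le_eqVlt => /orP[/eqP->|c0]; [by right|left].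
  by rewrite /left_part/= in_itv/= ac.
- apply: Build_ProperFilter => /nbhs_ballP[d /= d0 hd].
  apply: (hd (- Num.min (d / 2) a)); last first.
    by rewrite /left_part/= in_itv/= lerN2 ge_min lexx orbT oppr_lt0 lt_min a0; lra.
  rewrite /ball/= sub0r opprK ger0_norm ?le_min; last by lra.
  by rewrite gt_min; lra.
Qed.

Lemma right_part_one_side (b : R) : 0 < b -> one_side (right_part b).
Proof.
move=> b0; split.
- exact: interval_is_interval.
- exact: measurable_itv.
- move=> x; rewrite /right_part/= in_itv/= => /andP[x0 xb].
  exists (x / 2), b, (x / 2); split; [lra|apply/andP; lra| |].
    by apply: subset_itvr; rewrite bnd_simp; lra.
  by move=> z; rewrite /right_part/= in_itv/= ltr_distl => /andP[_ ->] /andP[+ _]/=; rewrite andbT; lra.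
- exists 0, b; split; [lra|by apply: subset_itvr; rewrite bnd_simp|].
  move=> c /andP[]; rewrite le_eqVlt => /orP[/eqP<-|c0] cb; [by right|left].
  by rewrite /right_part/= in_itv/= c0.
- apply: Build_ProperFilter => /nbhs_ballP[d /= d0 hd].
  apply: (hd (Num.min (d / 2) b)); last first.
    by rewrite /right_part/= in_itv/= ge_min lexx orbT lt_min b0; lra.
  rewrite /ball/= sub0r normrN ger0_norm ?le_min; last by lra.
  by rewrite gt_min; lra.
Qed.

Lemma at_left_left_part (a : R) : 0 < a -> 0^'- = within (left_part a) (nbhs (0:R)).
Proof.
move=> a0; apply/seteqP; split => A /nbhs_ballP[d /= d0 hd].
  apply/nbhs_ballP; exists d => //= z zd; rewrite /left_part/= in_itv/= => /andP[_ z0].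
  exact: hd.
apply/nbhs_ballP; exists (Num.min d a); first by rewrite /= lt_min d0.
move=> z /=; rewrite /ball/= sub0r normrN lt_min => /andP[zd za] z0; apply: hd.
  by rewrite /ball/= sub0r normrN.
by rewrite /left_part/= in_itv/= z0 andbT; move: za; rewrite ltr0_norm//; lra.
Qed.

Lemma at_right_right_part (b : R) : 0 < b -> 0^'+ = within (right_part b) (nbhs (0:R)).
Proof.
move=> b0; apply/seteqP; split => A /nbhs_ballP[d /= d0 hd].
  apply/nbhs_ballP; exists d => //= z zd; rewrite /right_part/= in_itv/= => /andP[z0 _].
  exact: hd.
apply/nbhs_ballP; exists (Num.min d b); first by rewrite /= lt_min d0.
move=> z /=; rewrite /ball/= sub0r normrN lt_min => /andP[zd za] z0; apply: hd.
  by rewrite /ball/= sub0r normrN.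
by rewrite /right_part/= in_itv/= z0/=; move: za; rewrite gtr0_norm//; lra.
Qed.

Lemma locally_ac_continuous_in J f x : one_side J ->
  locally_absolutely_continuous J f -> J x -> continuous_in J f x.
Proof.
move=> oJ fac Jx; have [l [r [d [d0 lxr sJ hd]]]] := one_side_segment oJ Jx.
have lr : l <= r by case/andP: lxr; exact: le_trans.
have /cvg_withinP h := ac_continuous_in (fac _ _ lr sJ) lxr.
apply/cvg_withinP => e /h[p p0 hp]; exists (Num.min d p); first by rewrite lt_min d0.
by move=> z Jz; rewrite lt_min => /andP[zd zp]; apply: hp => //; apply: hd.
Qed.

(** The limit at 0 compensates for the missing endpoint. *)
Lemma one_side_bounded J f (f0 : R[i]) : one_side J ->
  (forall x, J x -> continuous_in J f x) ->
  f z @[z --> within J (nbhs (0:R))] --> (f0 : R[i]^o) ->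
  exists2 K, 0 <= K & forall z, J z -> normc (f z) <= K.
Proof.
move=> oJ fc ff0; have [l [r [lr sJ Jclosure]]] := one_side_closure oJ.
suff [K hK] : exists K, forall z, J z -> z <= r -> normc (f z) <= K.
  exists `|K| => // z Jz; apply: le_trans (ler_norm _); apply: hK => //.
  by have /= := sJ _ Jz; rewrite in_itv/= => /andP[].
apply: (real_induction (Q := fun y => exists K, forall z, J z -> z <= y -> normc (f z) <= K) lr).
  exists (normc (f l)) => z /sJ/=; rewrite in_itv/= => /andP[lz _] zl.
  by rewrite (_ : z = l)//; apply/eqP; rewrite eq_le lz zl.
move=> c lcr; have [L fL] : exists L : R[i], f z @[z --> within J (nbhs c)] --> (L : R[i]^o).
  by have [/fc|->] := Jclosure _ lcr; [exists (f c)|exists f0].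
have [d d0 hd] := (cvg_withinP _ _ _ _).1 fL _ ltr01.
exists d => // x z lx xc cz zr dx zd [K hK].
exists (Num.max K (normc L + 1)) => y Jy yz.
rewrite le_max; have [yx|xy] := leP y x; first by rewrite hK.
apply/orP; right; have := hd y Jy.
have -> : `|y - c| < d by rewrite ltr_distlC; apply/andP; lra.
move=> /(_ isT); have := ler_normcD (f y - L) L; rewrite subrK; lra.
Qed.

(** [Re] and [Im] are 1-Lipschitz for the modulus. *)
Lemma continuous_in_measurable J f : measurable J ->
  (forall x, J x -> continuous_in J f x) ->
  measurable_fun J (fun x => complex.Re (f x)) /\
  measurable_fun J (fun x => complex.Im (f x)).
Proof.
move=> mJ fc; have key (p : R[i] -> R) :
    (forall z w, `|p z - p w| <= normc (z - w)) -> measurable_fun J (fun x => p (f x)).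
  move=> ple; apply: subspace_continuous_measurable_fun => //.
  apply/subspace_continuousP => x Jx; apply/(@cvgrPdist_le R R^o) => e e0.
  have [d d0 hd] := (cvg_withinP _ _ _ _).1 (fc x Jx) _ e0.
  apply/nbhs_ballP; exists d => //= z; rewrite /ball/= distrC => zd Jz.
  by rewrite distrC; apply: (le_trans (ple _ _)); exact: hd.
by split; apply: key => -[z1 z2] [w1 w2];
  [apply: (Re_le_normc (z1 +i* z2 - w1 +i* w2))|apply: (Im_le_normc (z1 +i* z2 - w1 +i* w2))].
Qed.

End intervals.

(** * Solutions of the differential equation *)
Section solutions.
Context {R : realType}.
Local Notation mu := (@lebesgue_measure R).
Implicit Types (J : set R) (q h y dy ddy u du v dv : R -> R[i]).

(** Solving the equation for the second derivative: its values can be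
    changed on a null set to be given by the equation at every point. *)
Lemma ode_twice_differentiable J q lam h y dy ddy :
  ode_solution J q lam h y dy ddy ->
  twice_differentiable J y dy (fun x => (q x - lam) * y x + h x).
Proof.
move=> [[yd dyac dyd] eqn]; split; [exact: yd|exact: dyac|].
apply: ae_imply2 dyd eqn => x dyx ex Jx.
have -> : (q x - lam) * y x + h x = ddy x; last exact: dyx.
by rewrite -(ex Jx) /ell; ring.
Qed.

Lemma homogeneous_twice_differentiable J q lam y dy ddy :
  ode_solution J q lam (fun=> 0) y dy ddy ->
  twice_differentiable J y dy (fun x => (q x - lam) * y x).
Proof.
move=> /ode_twice_differentiable[yd dyac dyd]; split; [exact: yd|exact: dyac|].
by apply: ae_imply dyd => x; rewrite addr0.
Qed.

Lemma twice_differentiable_continuous J y dy ddy x : twice_differentiable J y dy ddy ->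
  J x -> continuous_in J y x.
Proof. by move=> [yd _ _] Jx; exact: has_derivative_in_continuous (yd _ Jx). Qed.

Lemma twice_differentiable_continuous_derivative J y dy ddy x : one_side J ->
  twice_differentiable J y dy ddy -> J x -> continuous_in J dy x.
Proof. by move=> oJ [_ dyac _] Jx; exact: locally_ac_continuous_in. Qed.

Lemma twice_differentiable_ac J y dy ddy : twice_differentiable J y dy ddy ->
  locally_absolutely_continuous J y.
Proof.
move=> [yd dyac _] l r lr sJ; apply: (@derivative_ac _ _ _ _ dy lr); last exact: dyac.
move=> x xlr; apply: (has_derivative_in_sub sJ); apply: yd.
by apply: sJ; rewrite /= in_itv.
Qed.

(** [W' = u v'' - u'' v] vanishes almost everywhere, and [W] is absolutely
    continuous. *)
Lemma wronskian_constant J k u du v dv : is_interval J ->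
  twice_differentiable J u du (fun x => k x * u x) ->
  twice_differentiable J v dv (fun x => k x * v x) ->
  forall (x t : R), J x -> J t -> wronskian u du v dv x = wronskian u du v dv t.
Proof.
move=> iJ us vs.
suff W (x y : R) : J x -> J y -> x <= y -> wronskian u du v dv x = wronskian u du v dv y.
  by move=> x t Jx Jt; have [xt|/ltW tx] := leP x t; [|apply/esym]; exact: W.
move=> Jx Jy xy; have sJ := interval_segment iJ Jx Jy.
have [ud duac dud] := us; have [vd dvac dvd] := vs.
have uac := twice_differentiable_ac us xy sJ.
have vac := twice_differentiable_ac vs xy sJ.
pose W t := u t * dv t + (- 1) * (du t * v t).
have WE t : wronskian u du v dv t = W t by rewrite /wronskian /W mulN1r.
apply/eqP; rewrite eq_sym -subr_eq0 !WE; apply/eqP/eq0_normc/eqP.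
rewrite eq_le normc_ge0 andbT -[leRHS](mul0r (y - x)).
apply: (ac_derivative_bound (lexx 0) xy).
  apply: acD; first by apply: acM => //; exact: dvac.
  by apply: acM => //; [exact: ac_cst|apply: acM => //; exact: duac].
apply: ae_imply2 dud dvd => t dut dvt xty.
have Jt : J t by apply: sJ; rewrite /= in_itv.
exists (du t * dv t + u t * (k t * v t)
        + (0 * (du t * v t) + (- 1) * (k t * u t * v t + du t * dv t))).
  have sub f d : has_derivative_in J f t d -> has_derivative_in `[x, y] f t d.
    exact: has_derivative_in_sub.
  apply: has_derivative_inD.
    by apply: has_derivative_inM; apply: sub; [exact: ud|exact: dvt].
  apply: has_derivative_inM; first exact: has_derivative_in_cst.
  by apply: has_derivative_inM; apply: sub; [exact: dut|exact: vd].
by rewrite (_ : _ + _ = 0) ?normc0//; ring.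
Qed.

Lemma dominated_square_integrable J y (m : R -> R) : measurable J ->
  measurable_fun J (fun x => complex.Re (y x)) ->
  measurable_fun J (fun x => complex.Im (y x)) ->
  mu.-integrable J (EFin \o m) ->
  (forall x, J x -> normc (y x) ^+ 2 <= m x) ->
  square_integrable J y.
Proof.
move=> mJ mRe mIm im ym; split; [exact: mRe|exact: mIm|].
apply: (le_integrable _ _ _ im); first exact: mJ.
  by apply/measurable_EFinP; apply: measurable_funD; apply: measurable_funX.
move=> x Jx /=; rewrite lee_fin -normc_sqr; apply: le_trans (ler_norm _).
by rewrite ger0_norm ?sqr_ge0//; exact: ym.
Qed.

Lemma one_side_integrable_cst J (k : R) : one_side J ->
  mu.-integrable J (EFin \o (fun=> k)).
Proof.
move=> oJ; have [l [r [lr sJ _]]] := one_side_closure oJ.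
have mJ := one_side_measurable oJ.
apply: measurable_bounded_integrable => //; last exact: bounded_cst.
apply: (@le_lt_trans _ _ (mu `[l, r])); first by apply: le_measure; rewrite ?inE.
by rewrite lebesgue_measure_itv/=; case: ifP => _ //; rewrite -EFinD ltry.
Qed.

Lemma bounded_square_integrable J y K : one_side J ->
  (forall x, J x -> continuous_in J y x) ->
  (forall x, J x -> normc (y x) <= K) -> square_integrable J y.
Proof.
move=> oJ yc yK; have mJ := one_side_measurable oJ.
have [mRe mIm] := continuous_in_measurable mJ yc.
apply: (dominated_square_integrable (m := fun=> K ^+ 2)) => //.
  exact: one_side_integrable_cst.
move=> x Jx; have y0 := normc_ge0 (y x); have yx := yK x Jx.
by apply: lerXn2r => //; rewrite nnegrE; lra.
Qed.

(** A solution and its derivative are bounded as soon as they have limits at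
    0, and [ell y = lam y - h]. The second derivative has to be chosen equal to
    [(q - lam) y + h] everywhere: an arbitrary representative of it need not be
    Borel measurable. *)
Lemma L2_solution J q lam h y dy (y0 dy0 : R[i]) : one_side J ->
  square_integrable J h ->
  twice_differentiable J y dy (fun x => (q x - lam) * y x + h x) ->
  y z @[z --> within J (nbhs (0:R))] --> (y0 : R[i]^o) ->
  dy z @[z --> within J (nbhs (0:R))] --> (dy0 : R[i]^o) ->
  L2_ode_solution J q lam h y dy.
Proof.
move=> oJ [hRe hIm hi] ys yy0 dydy0; have mJ := one_side_measurable oJ.
have yc x := @twice_differentiable_continuous _ _ _ _ x ys.
have dyc x := @twice_differentiable_continuous_derivative _ _ _ _ x oJ ys.
have [K K0 yK] := one_side_bounded oJ yc yy0.
have [L L0 dyL] := one_side_bounded oJ dyc dydy0.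
exists (fun x => (q x - lam) * y x + h x).
have ellE x : ell q y (fun x => (q x - lam) * y x + h x) x = lam * y x - h x.
  by rewrite /ell; ring.
split.
- split=> //; apply: (@ae_imply _ (fun=> True)); last first.
    by exists set0; split => // x; apply.
  by move=> x _ _; rewrite ellE; ring.
- exact: bounded_square_integrable yK.
- exact: bounded_square_integrable dyL.
- have [mRe mIm] := continuous_in_measurable mJ yc.
  apply: (dominated_square_integrable
    (m := fun x => 2 * (normc lam * K) ^+ 2 +
                   2 * (complex.Re (h x) ^+ 2 + complex.Im (h x) ^+ 2))) => //.
  + rewrite (_ : (fun x => _) = fun x => complex.Re lam * complex.Re (y x)
      - complex.Im lam * complex.Im (y x) - complex.Re (h x)).
      by apply: measurable_funB => //; apply: measurable_funB;
        apply: measurable_funM.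
    by apply/funext => x; rewrite ellE complex_ReD complex_ReN complex_ReM.
  + rewrite (_ : (fun x => _) = fun x => complex.Re lam * complex.Im (y x)
      + complex.Im lam * complex.Re (y x) - complex.Im (h x)).
      by apply: measurable_funB => //; apply: measurable_funD;
        apply: measurable_funM.
    by apply/funext => x; rewrite ellE complex_ImD complex_ImN complex_ImM.
  + rewrite (_ : _ \o _ = fun x => ((2 * (normc lam * K) ^+ 2)%:E +
        2%:E * (complex.Re (h x) ^+ 2 + complex.Im (h x) ^+ 2)%:E)%E)//.
    apply: integrableD => //; last exact: integrableZl.
    exact: one_side_integrable_cst.
  + move=> x Jx; rewrite ellE -normc_sqr.
    have A : normc (lam * y x) <= normc lam * K.
      by rewrite normcM ler_wpM2l ?normc_ge0// yK.
    have B := ler_normcD (lam * y x) (- h x); rewrite normc_oppE in B.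
    have C := normc_ge0 (lam * y x - h x); have D := normc_ge0 (lam * y x).
    have E := normc_ge0 (h x).
    have F : normc (lam * y x - h x) <= normc lam * K + normc (h x) by lra.
    have G : normc (lam * y x - h x) ^+ 2 <= (normc lam * K + normc (h x)) ^+ 2.
      by apply: lerXn2r => //; rewrite nnegrE; lra.
    have H := sqr_ge0 (normc lam * K - normc (h x)).
    apply: (le_trans G); rewrite -subr_ge0; apply: le_trans H _.
    rewrite le_eqVlt; apply/orP; left; apply/eqP; ring.
Qed.

End solutions.

(** * Primitives of integrable functions *)
Section integrals.
Context {R : realType}.
Local Notation mu := (@lebesgue_measure R).
Implicit Types (D : set R) (f g : R -> R[i]).

Definition cutoff D f : R -> R[i] := fun x => if x \in D then f x else 0.

Lemma Re_cutoff D f :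
  (fun x => complex.Re (cutoff D f x)) = (fun x => complex.Re (f x)) \_ D.
Proof. by apply/funext => x; rewrite patchE /cutoff; case: ifP. Qed.

Lemma Im_cutoff D f :
  (fun x => complex.Im (cutoff D f x)) = (fun x => complex.Im (f x)) \_ D.
Proof. by apply/funext => x; rewrite patchE /cutoff; case: ifP. Qed.

Lemma complex_integral_cutoff D f :
  complex_integral D f = complex_integral setT (cutoff D f).
Proof.
by rewrite /complex_integral !(Rintegral_mkcond mu D) -Re_cutoff -Im_cutoff.
Qed.

Lemma complex_integrable_cutoff D f : measurable D ->
  complex_integrable D f <-> complex_integrable setT (cutoff D f).
Proof.
move=> mD; rewrite /complex_integrable.
have HR := @integrable_mkcond _ _ _ mu D (EFin \o (fun x => complex.Re (f x))) mD.
have HI := @integrable_mkcond _ _ _ mu D (EFin \o (fun x => complex.Im (f x))) mD.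
rewrite restrict_EFin -Re_cutoff in HR; rewrite restrict_EFin -Im_cutoff in HI.
by split=> -[/HR ? /HI ?].
Qed.

Lemma complex_integrableD f g : complex_integrable setT f ->
  complex_integrable setT g -> complex_integrable setT (fun x => f x + g x).
Proof.
move=> [fR fI] [gR gI]; split.
- rewrite (_ : (fun _ => _) = (fun x => (complex.Re (f x))%:E) \+
    (fun x => (complex.Re (g x))%:E))%E; first exact: integrableD.
  by apply/funext => x /=; rewrite complex_ReD EFinD.
- rewrite (_ : (fun _ => _) = (fun x => (complex.Im (f x))%:E) \+
    (fun x => (complex.Im (g x))%:E))%E; first exact: integrableD.
  by apply/funext => x /=; rewrite complex_ImD EFinD.
Qed.

Lemma complex_integralD f g : complex_integrable setT f ->
  complex_integrable setT g ->
  complex_integral setT (fun x => f x + g x) =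
  complex_integral setT f + complex_integral setT g.
Proof.
move=> [fR fI] [gR gI]; rewrite /complex_integral.
under eq_Rintegral do rewrite complex_ReD.
under [in X in (_ +i* X)%C]eq_Rintegral do rewrite complex_ImD.
by rewrite !RintegralD.
Qed.

Lemma complex_integrableZ (k : R[i]) f : complex_integrable setT f ->
  complex_integrable setT (fun x => k * f x).
Proof.
move=> [fR fI]; split.
- rewrite (_ : (fun _ => _) = (fun x => (complex.Re k)%:E * (complex.Re (f x))%:E) \+
    (fun x => (- complex.Im k)%:E * (complex.Im (f x))%:E))%E.
    by apply: integrableD => //; exact: integrableZl.
  by apply/funext => x /=; rewrite complex_ReM -!EFinM -EFinD mulNr.
- rewrite (_ : (fun _ => _) = (fun x => (complex.Re k)%:E * (complex.Im (f x))%:E) \+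
    (fun x => (complex.Im k)%:E * (complex.Re (f x))%:E))%E.
    by apply: integrableD => //; exact: integrableZl.
  by apply/funext => x /=; rewrite complex_ImM -!EFinM -EFinD.
Qed.

Lemma complex_integralZ (k : R[i]) f : complex_integrable setT f ->
  complex_integral setT (fun x => k * f x) = k * complex_integral setT f.
Proof.
move=> [fR fI]; rewrite /complex_integral.
have Z (c : R) (h : R -> R) : mu.-integrable setT (fun x => (h x)%:E) ->
    mu.-integrable setT (EFin \o (fun x => c * h x)).
  move=> hi; rewrite (_ : _ \o _ = fun x => (c%:E * (h x)%:E)%E)//.
  exact: integrableZl.
under eq_Rintegral do rewrite complex_ReM -mulNr.
under [in X in (_ +i* X)%C]eq_Rintegral do rewrite complex_ImM.
rewrite !RintegralD//; try exact: Z.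
rewrite !RintegralZl//.
case: k => k1 k2; apply/eqP; rewrite eq_complex /= mulNr.
by rewrite !eqxx.
Qed.

(** Starting at minus infinity makes this defined on all of [R]; on a function
    that vanishes outside []-a, b[] it is the integral from [-a]. *)
Definition primitive f (x : R) : R[i] := complex_integral `]-oo, x] f.

Lemma integral_increment (h : R -> R) (x y : R) : x <= y ->
  mu.-integrable setT (EFin \o h) ->
  \int[mu]_(t in `]-oo, y]%classic) h t - \int[mu]_(t in `]-oo, x]%classic) h t =
  \int[mu]_(t in `]x, y]%classic) h t.
Proof.
by move=> xy hi; rewrite Rintegral_itvB//; apply: integrableS hi.
Qed.

(** The absolute continuity of the integral, applied to the union of the
    intervals. *)
Lemma sum_integral_small (m : R -> R) (e : R) : (forall x, 0 <= m x) ->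
  mu.-integrable setT (EFin \o m) -> 0 < e ->
  exists2 d : R, 0 < d & forall (n : nat) (s t : 'I_n -> R),
    (forall i, s i <= t i) ->
    (forall i j : 'I_n, (i < j)%N -> t i <= s j) ->
    \sum_(i < n) (t i - s i) < d ->
    \sum_(i < n) \int[mu]_(x in `]s i, t i]%classic) m x < e.
Proof.
move=> m0 im e0; have [d [d0 hd]] := integral_normr_continuous im e0.
exists d => // n s t st ts sumd.
pose F (i : 'I_n) : set R := `]s i, t i]%classic.
have mF i : measurable (F i) by exact: measurable_itv.
have disj (i j : 'I_n) : (i < j)%N -> F i `&` F j = set0.
  move=> ij; rewrite -subset0 => x [] /=; rewrite /F/= !in_itv/=.
  move=> /andP[_ xt] /andP[sx _]; have := ts _ _ ij; lra.
have tF : trivIset [set` index_enum 'I_n] F.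
  apply/trivIsetP => i j _ _ ij; have [/disj//|ji] := ltnP i j.
  by rewrite setIC; apply: disj; rewrite ltn_neqAle ji andbT eq_sym.
pose D := \big[setU/set0]_(i < n) F i.
have mD : measurable D by exact: bigsetU_measurable.
have muD : mu D = (\sum_(i < n) (t i - s i))%:E.
  have I1 A : measurable A -> (\int[mu]_(x in A) cst 1%E x = mu A)%E.
    by move=> mA; have := integral_cst mu mA 1%E; rewrite mul1e.
  rewrite -(I1 _ mD) ge0_integral_bigsetU//; last exact: index_enum_uniq.
  rewrite -sumEFin; apply: eq_bigr => i _.
  rewrite (I1 _ (mF i)) lebesgue_measure_itv/= lte_fin; case: ltP => //.
  by move=> tsi; rewrite (_ : t i = s i) ?subrr//; apply/eqP; rewrite eq_le tsi st.
have muDd : (mu D < d%:E)%E by rewrite muD lte_fin.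
have := hd D mD muDd.
apply: le_lt_trans; rewrite le_eqVlt; apply/orP; left; apply/eqP; apply: esym.
rewrite (_ : (fun x => `|m x|) = m); last by apply/funext => x; rewrite ger0_norm.
have iF A : measurable A -> mu.-integrable A (EFin \o m).
  by move=> mA; apply: integrableS im.
rewrite /Rintegral (@ge0_integral_bigsetU _ _ _ mu _ F)//; last 3 first.
- exact: index_enum_uniq.
- by have /integrableP[] := iF D mD.
- by move=> x _; rewrite lee_fin.
rewrite sum_fine// => i _; by apply: integrable_fin_num; [exact: mF|exact: (iF _ (mF i))].
Qed.

Lemma real_derivative_le (F : R -> R) (x c : R) :
  derivable F x 1 -> F^`()%classic x = c -> forall e, 0 < e ->
  exists2 d, 0 < d & forall z, `|z - x| < d ->
    `|F z - F x - (z - x) * c| <= e * `|z - x|.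
Proof.
move=> dF Fc e e0; have := dF; rewrite -/(derivable F x 1) /derivable.
move=> /cvg_ex[l hl].
have lc : l = c by rewrite -Fc derive1E; apply/esym/cvg_lim => //; exact: hl.
move: hl; rewrite lc => /(@cvgrPdist_le R R^o) /(_ _ e0) /nbhs_ballP[d /= d0 hd].
exists d => // z zd; have [->|zx] := eqVneq z x.
  by rewrite !subrr mul0r subrr !normr0 mulr0.
have zx0 : z - x != 0 by rewrite subr_eq0.
have := hd (z - x); rewrite /ball/= sub0r normrN => /(_ zd zx0).
rewrite /GRing.scale/= mulr1 subrK distrC => H.
have -> : F z - F x - (z - x) * c = (z - x) * ((z - x)^-1 * (F z - F x) - c).
  by field.
by rewrite normrM mulrC ler_wpM2r.
Qed.

(** Lebesgue's differentiation theorem for the real and the imaginary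
    part. *)
Lemma primitive_ae_derivative f : complex_integrable setT f ->
  {ae mu, forall x, has_derivative_in setT (primitive f) x (f x)}.
Proof.
move=> [fR fI].
have key (h : R -> R) : mu.-integrable setT (EFin \o h) ->
    {ae mu, forall x : R, derivable (fun y : R => \int[mu]_(t in `]-oo, y]%classic) h t) x 1 /\
      (fun y : R => \int[mu]_(t in `]-oo, y]%classic) h t)^`()%classic x = h x}.
  move=> hi; apply: FTC1Ny; first by move=> y; apply: integrableS hi.
  by apply: open_integrable_locally => //; exact: openT.
apply: ae_imply2 (key _ fR) (key _ fI) => x [dR eR] [dI eI].
apply/has_derivative_inP => e e0.
have e2 : 0 < e / 2 by rewrite divr_gt0.
have [r r0 hr] := real_derivative_le dR eR e2.
have [s s0 hs] := real_derivative_le dI eI e2.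
exists (Num.min r s); first by rewrite lt_min r0.
move=> z _; rewrite lt_min => /andP[zr zs]; apply: (le_trans (normc_le_ReIm _)).
rewrite !complex_ReD !complex_ImD !complex_ReN !complex_ImN complex_ReM complex_ImM/=.
rewrite !mul0r subr0 addr0.
have := hr _ zr; have := hs _ zs; lra.
Qed.

(** The real integrand on the right is not the modulus but an upper bound of
    it, obtained from the real and imaginary parts separately. *)
Lemma primitive_increment f x y : complex_integrable setT f -> x <= y ->
  normc (primitive f y - primitive f x) <=
  \int[mu]_(t in `]x, y]%classic) (`|complex.Re (f t)| + `|complex.Im (f t)|).
Proof.
move=> [fR fI] xy; apply: (le_trans (normc_le_ReIm _)).
rewrite complex_ReD complex_ImD complex_ReN complex_ImN /primitive /=.
rewrite !integral_increment//.
have mxy : measurable (`]x, y] : set R) by exact: measurable_itv.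
have S h : mu.-integrable setT (EFin \o h) -> mu.-integrable `]x, y] (EFin \o h).
  by move=> hi; apply: integrableS hi.
have A h : mu.-integrable setT (EFin \o h) ->
    mu.-integrable `]x, y] (EFin \o (fun t => `|h t|)).
  by move=> /S/integrable_abse.
rewrite RintegralD//; try exact: A.
by apply: lerD; apply: le_normr_Rintegral => //; exact: S.
Qed.

Lemma primitive_ac l r f : complex_integrable setT f ->
  absolutely_continuous_on l r (primitive f).
Proof.
move=> fi; have [fR fI] := fi; apply/absolutely_continuous_onP => e e0.
pose m t := `|complex.Re (f t)| + `|complex.Im (f t)|.
have m0 t : 0 <= m t by rewrite addr_ge0.
have im : mu.-integrable setT (EFin \o m).
  rewrite (_ : _ \o _ = (abse \o (fun t => (complex.Re (f t))%:E)) \+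
    (abse \o (fun t => (complex.Im (f t))%:E)))%E//.
  by apply: integrableD => //; exact: integrable_abse.
have [d d0 hd] := sum_integral_small m0 im e0.
exists d => // n s t h1 h2 h3.
have st i : s i <= t i by have [_ []] := h1 i.
apply: le_lt_trans (hd _ _ _ st h2 h3).
by apply: ler_sum => i _; exact: primitive_increment.
Qed.

Lemma primitive_cvg J f (c : R) : complex_integrable setT f ->
  primitive f z @[z --> within J (nbhs c)] --> (primitive f c : R[i]^o).
Proof.
move=> fi; apply/cvg_withinP => e e0.
have [d d0 hd] := ac_uniform (primitive_ac (c - 1) (c + 1) fi) e0.
exists (Num.min d 1); first by rewrite lt_min d0 ltr01.
move=> z _; rewrite lt_min => /andP[zd]; rewrite ltr_distl => /andP[z1 z2].
by apply: hd => //; apply/andP; lra.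
Qed.

Lemma complex_integrable_cutoffS D f : measurable D ->
  complex_integrable setT f -> complex_integrable setT (cutoff D f).
Proof.
move=> mD [fR fI]; apply/(complex_integrable_cutoff _ mD).
by split; [apply: integrableS fR|apply: integrableS fI].
Qed.

Lemma complex_integral_itv_bndo_bndc f (x : R) : complex_integrable setT f ->
  complex_integral `]-oo, x[ f = primitive f x.
Proof.
move=> [fR fI]; rewrite /primitive /complex_integral !Rintegral_itv_bndo_bndc//.
- by apply: integrableS fI.
- by apply: integrableS fR.
Qed.

Lemma complex_integral_itvoy f (x : R) : complex_integrable setT f ->
  complex_integral `]x, +oo[ f = complex_integral setT f - primitive f x.
Proof.
move=> fi; have mx : measurable (`]x, +oo[ : set R) by exact: measurable_itv.
have mNx : measurable (`]-oo, x] : set R) by exact: measurable_itv.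
apply/eqP; rewrite eq_sym subr_eq /primitive; apply/eqP.
rewrite [X in _ = X + _]complex_integral_cutoff [X in _ = _ + X]complex_integral_cutoff.
rewrite -complex_integralD; [|exact: complex_integrable_cutoffS..].
congr complex_integral; apply/funext => t; rewrite /cutoff !mem_setE !in_itv/= andbT.
by case: ltP => _; rewrite ?addr0 ?add0r.
Qed.

Lemma complex_integral_eq0 f : (forall x, f x = 0) -> complex_integral setT f = 0.
Proof.
move=> f0; rewrite /complex_integral.
under eq_Rintegral do rewrite f0.
under [in X in (_ +i* X)%C]eq_Rintegral do rewrite f0.
by rewrite /Rintegral !integral0_eq.
Qed.

Lemma primitive_cutoff_left (a b : R) f :
  primitive (cutoff `](- a), b[ f) (- a) = 0.
Proof.
rewrite /primitive complex_integral_cutoff; apply: complex_integral_eq0 => x.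
rewrite /cutoff !mem_setE !in_itv/=; case: ifP => // xa.
by rewrite ltNge xa.
Qed.

Lemma primitive_cutoff_right (a b : R) f :
  primitive (cutoff `](- a), b[ f) b = complex_integral setT (cutoff `](- a), b[ f).
Proof.
rewrite /primitive complex_integral_cutoff; congr complex_integral; apply/funext => x.
rewrite /cutoff !mem_setE !in_itv/=; case: (leP x b) => // bx.
by rewrite [x < b]ltNge (ltW bx) andbF.
Qed.

End integrals.

(** * Variation of parameters and the Green's function *)
Section green_function.
Context {R : realType}.
Local Notation mu := (@lebesgue_measure R).
Implicit Types (J D : set R) (f k q h y dy u du v dv P Q : R -> R[i]).

(** In the derivative of [v P + u Q] the terms [v (u h)] and [u (- v h)]
    cancel; in that of [v' P + u' Q] the terms [v' (u h)] and [u' (- v h)] add up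
    to the Wronskian times [h]. *)
Lemma variation_of_parameters J k h u du v dv P Q (psi : R[i]) : one_side J ->
  twice_differentiable J u du (fun x => k x * u x) ->
  twice_differentiable J v dv (fun x => k x * v x) ->
  (forall x, J x -> wronskian u du v dv x = psi) -> psi != 0 ->
  locally_absolutely_continuous J P -> locally_absolutely_continuous J Q ->
  {ae mu, forall x, J x -> has_derivative_in J P x (u x * h x)} ->
  {ae mu, forall x, J x -> has_derivative_in J Q x (- (v x * h x))} ->
  let y x := (v x * P x + u x * Q x) * psi^-1 in
  let dy x := (dv x * P x + du x * Q x) * psi^-1 in
  twice_differentiable J y dy (fun x => k x * y x + h x).
Proof.
move=> oJ us vs W psi0 Pac Qac dP dQ y dy.
have [ud duac dud] := us; have [vd dvac dvd] := vs.
have uac := twice_differentiable_ac us; have vac := twice_differentiable_ac vs.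
have comb f g : locally_absolutely_continuous J f -> locally_absolutely_continuous J g ->
    locally_absolutely_continuous J (fun x => (f x * P x + g x * Q x) * psi^-1).
  move=> fac gac l r lr sJ; apply: acM => //; last exact: ac_cst.
  by apply: acD; apply: acM => //;
    [exact: (fac l r)|exact: (Pac l r)|exact: (gac l r)|exact: (Qac l r)].
have combd f g x df dg : has_derivative_in J f x df -> has_derivative_in J g x dg ->
    has_derivative_in J P x (u x * h x) -> has_derivative_in J Q x (- (v x * h x)) ->
    has_derivative_in J (fun x => (f x * P x + g x * Q x) * psi^-1) x
      ((df * P x + f x * (u x * h x) + (dg * Q x + g x * - (v x * h x))) * psi^-1
       + (f x * P x + g x * Q x) * 0).
  move=> fd gd Px Qx; apply: (@has_derivative_inM _ _ _ (fun=> psi^-1)).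
    by apply: has_derivative_inD; apply: has_derivative_inM.
  exact: has_derivative_in_cst.
have dyac : locally_absolutely_continuous J dy by exact: comb.
split.
- move=> x Jx; have dyc := locally_ac_continuous_in oJ dyac Jx.
  apply: (ac_ae_derivative (one_side_itv oJ) (comb _ _ vac uac) _ Jx dyc).
  apply: ae_imply2 dP dQ => t Pt Qt Jt.
  have := combd _ _ _ _ _ (vd t Jt) (ud t Jt) (Pt Jt) (Qt Jt).
  have -> : dv t * P t + v t * (u t * h t) + (du t * Q t + u t * - (v t * h t))
      = dv t * P t + du t * Q t by ring.
  by rewrite mulr0 addr0; exact.
- exact: dyac.
- have dPQ := ae_imply2 (fun x a b => conj a b) dP dQ.
  (* The terms with P' and Q' add up to the Wronskian times h, over psi. *)
have duv := ae_imply2 (fun x a b => conj a b) dud dvd.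
  apply: ae_imply2 dPQ duv => t [Pt Qt] [ut vt] Jt.
  have := combd _ _ _ _ _ (vt Jt) (ut Jt) (Pt Jt) (Qt Jt).
  rewrite mulr0 addr0.
  have W1 : (u t * dv t - du t * v t) * psi^-1 = 1.
    by have := W t Jt; rewrite /wronskian => ->; rewrite mulfV.
  have -> : k t * y t + h t =
      (k t * v t * P t + dv t * (u t * h t) + (k t * u t * Q t + du t * - (v t * h t)))
      * psi^-1.
    by rewrite -[X in _ + X]mul1r -W1 /y; ring.
  exact.
Qed.

(** The integrand is cut off to [D]; at the endpoint [c] of [J] it may differ
    from [f], but a point is negligible. *)
Lemma primitive_cutoff_side D J f (c : R) : measurable D ->
  complex_integrable D f -> J `\ c `<=` D ->
  {ae mu, forall x, J x -> has_derivative_in J (primitive (cutoff D f)) x (f x)}.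
Proof.
move=> mD /(complex_integrable_cutoff _ mD) fi JD.
apply: ae_imply2 (primitive_ae_derivative fi) (ae_neq c) => x fx xc Jx.
have Dx : x \in D by rewrite inE; apply: JD; split=> //; exact/eqP.
by move: fx; rewrite {2}/cutoff Dx; apply: has_derivative_in_sub.
Qed.

(** The coefficient of [u] is the integral of [v h] over []x, b[], written as the
    total integral minus the primitive. *)
Lemma green_side D J k h u du v dv (psi : R[i]) (c : R) : one_side J ->
  measurable D -> J `\ c `<=` D ->
  twice_differentiable J u du (fun x => k x * u x) ->
  twice_differentiable J v dv (fun x => k x * v x) ->
  (forall x, J x -> wronskian u du v dv x = psi) -> psi != 0 ->
  complex_integrable D (fun t => u t * h t) ->
  complex_integrable D (fun t => v t * h t) ->
  let P := primitive (cutoff D (fun t => u t * h t)) in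
  let k2 := cutoff D (fun t => v t * h t) in
  let Q x := complex_integral setT k2 + - 1 * primitive k2 x in
  let y x := (v x * P x + u x * Q x) * psi^-1 in
  let dy x := (dv x * P x + du x * Q x) * psi^-1 in
  twice_differentiable J y dy (fun x => k x * y x + h x).
Proof.
move=> oJ mD JD us vs W psi0 ui vi P k2 Q.
have dP := primitive_cutoff_side mD ui JD.
have dk2 := primitive_cutoff_side mD vi JD.
have /(complex_integrable_cutoff _ mD) ui' := ui.
have /(complex_integrable_cutoff _ mD) vi' := vi.
apply: (variation_of_parameters oJ us vs W psi0 _ _ dP).
- by move=> l r _ _; exact: primitive_ac.
- move=> l r lr _; apply: acD; first exact: ac_cst.
  by apply: acM => //; [exact: ac_cst|exact: primitive_ac].
apply: ae_imply dk2 => x Px Jx; have {}Px := Px Jx.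
have -> : - (v x * h x) = 0 + (0 * primitive k2 x + - 1 * (v x * h x)) by ring.
apply: has_derivative_inD; first exact: has_derivative_in_cst.
by apply: has_derivative_inM Px; exact: has_derivative_in_cst.
Qed.

(** The value at 0 is arbitrary; a function is measurable on a singleton. *)
Lemma measurable_fun_two_sides (a b : R) (f : R -> R) :
  measurable_fun (left_part a) f -> measurable_fun (right_part b) f ->
  measurable_fun `](- a), b[ f.
Proof.
move=> ml mr; apply: (@measurable_funS _ _ _ _ (left_part a `|` [set 0] `|` right_part b)).
- by do 2?[apply: measurableU]; [exact: measurable_itv|exact: measurable_set1|exact: measurable_itv].
- move=> x; rewrite /left_part /right_part/= !in_itv/= => /andP[ax xb].
  have [x0|x0|->] := ltgtP x 0; [left; left|right|left; right] => //.
    by rewrite ltW.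
  by rewrite ltW.
- apply/measurable_funU; [by apply: measurableU; [exact: measurable_itv|exact: measurable_set1]|
    exact: measurable_itv|split=> //].
  by apply/measurable_funU; [exact: measurable_itv|exact: measurable_set1|split=> //;
    exact: measurable_fun_set1].
Qed.

(** On a bounded interval square integrable functions are integrable, by
    [|h| <= 1 + |h|^2]. *)
Lemma weighted_integrable (a b : R) (w h : R -> R[i]) (K : R) :
  measurable_fun `](- a), b[%classic (fun x : R => complex.Re (w x)) ->
  measurable_fun `](- a), b[%classic (fun x : R => complex.Im (w x)) ->
  (forall x, - a < x < b -> normc (w x) <= K) ->
  square_integrable `](- a), b[ h ->
  complex_integrable `](- a), b[ (fun x => w x * h x).
Proof.
move=> wR wI wK [hR hI hi].
have mD : measurable (`](- a), b[ : set R) by exact: measurable_itv.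
pose D : set R := `](- a), b[%classic.
have muD : (mu D < +oo)%E.
  by rewrite lebesgue_measure_itv/=; case: ifP => _ //; rewrite -EFinD ltry.
have iK : mu.-integrable D (EFin \o (fun=> K)).
  by apply: measurable_bounded_integrable => //; exact: bounded_cst.
(* K bounds w, and the modulus of h is at most one plus its square. *)
pose m (x : R) := K + K * (complex.Re (h x) ^+ 2 + complex.Im (h x) ^+ 2).
have im : mu.-integrable D (EFin \o m).
  rewrite (_ : _ \o _ = fun x => (K%:E +
    K%:E * (complex.Re (h x) ^+ 2 + complex.Im (h x) ^+ 2)%:E)%E)//.
  by apply: integrableD => //; exact: integrableZl.
have le_m x : - a < x < b -> normc (w x * h x) <= m x.
  move=> xab; rewrite normcM /m -normc_sqr -[X in X + _]mulr1 -mulrDr.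
  by apply: ler_pM; rewrite ?normc_ge0 ?wK//; have := sqr_ge0 (normc (h x) - 1 / 2); nra.
split.
- apply: (le_integrable _ _ _ im); [exact: mD| |].
    apply/measurable_EFinP; under eq_fun do rewrite complex_ReM.
    by apply: measurable_funB; apply: measurable_funM.
  move=> x xD; have xab : - a < x < b by have := xD; rewrite /D/= in_itv.
  rewrite lee_fin.
  apply: (le_trans (Re_le_normc _)); apply: (le_trans (le_m _ xab)); exact: ler_norm.
- apply: (le_integrable _ _ _ im); [exact: mD| |].
    apply/measurable_EFinP; under eq_fun do rewrite complex_ImM.
    by apply: measurable_funD; apply: measurable_funM.
  move=> x xD; have xab : - a < x < b by have := xD; rewrite /D/= in_itv.
  rewrite lee_fin.
  apply: (le_trans (Im_le_normc _)); apply: (le_trans (le_m _ xab)); exact: ler_norm.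
Qed.

(** Splitting at [t = x]. This holds for all real [x], so the formula for the
    integral below is an identity between functions on [R]. *)
Lemma green_cutoff D u v h (psi : R[i]) x :
  cutoff D (fun t => green u v psi x t * h t) =
  fun t => v x * psi^-1 * cutoff `]-oo, x[ (cutoff D (fun t => u t * h t)) t +
           u x * psi^-1 * cutoff `]x, +oo[ (cutoff D (fun t => v t * h t)) t.
Proof.
apply/funext => t; rewrite /cutoff /green !mem_setE !in_itv/= andbT.
by case: ltgtP => _; case: ifP => _; rewrite ?mulr0 ?add0r ?addr0 ?mul0r//; ring.
Qed.

Lemma green_integrable D u v h (psi : R[i]) x : measurable D ->
  complex_integrable D (fun t => u t * h t) -> complex_integrable D (fun t => v t * h t) ->
  complex_integrable D (fun t => green u v psi x t * h t).
Proof.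
move=> mD /(complex_integrable_cutoff _ mD) ui /(complex_integrable_cutoff _ mD) vi.
apply/(complex_integrable_cutoff _ mD); rewrite green_cutoff.
apply: complex_integrableD; apply: complex_integrableZ; apply: complex_integrable_cutoffS => //;
  exact: measurable_itv.
Qed.

Lemma green_integral D u v h (psi : R[i]) x : measurable D ->
  complex_integrable D (fun t => u t * h t) -> complex_integrable D (fun t => v t * h t) ->
  let k1 := cutoff D (fun t => u t * h t) in
  let k2 := cutoff D (fun t => v t * h t) in
  complex_integral D (fun t => green u v psi x t * h t) =
  (v x * primitive k1 x + u x * (complex_integral setT k2 + - 1 * primitive k2 x)) * psi^-1.
Proof.
move=> mD /(complex_integrable_cutoff _ mD) ui /(complex_integrable_cutoff _ mD) vi k1 k2.
have mo : measurable (`]-oo, x[ : set R) by exact: measurable_itv.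
have mp : measurable (`]x, +oo[ : set R) by exact: measurable_itv.
have i1 := complex_integrable_cutoffS mo ui.
have i2 := complex_integrable_cutoffS mp vi.
rewrite complex_integral_cutoff green_cutoff complex_integralD;
  [|exact: complex_integrableZ..].
rewrite !complex_integralZ// -(complex_integral_cutoff `]-oo, x[%classic k1).
rewrite -(complex_integral_cutoff `]x, +oo[%classic k2).
rewrite complex_integral_itv_bndo_bndc// complex_integral_itvoy// -/k1 -/k2. ring.
Qed.

End green_function.

(** * Solutions coupled across the origin *)
Section coupling.
Context {R : realType}.
Local Notation mu := (@lebesgue_measure R).
Implicit Types (J D : set R) (f k q h y dy u du v dv w dw : R -> R[i]).

(** The transmission conditions, solved for the values on the right; this is
    also the action of the transfer matrix written in two steps. *)
Definition transmitted (m n ym yp dym dyp : R[i]) : Prop :=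
  yp = ym + n * dym /\ dyp = dym + m * yp.

Lemma transfer_matrixP (m n ym yp dym dyp : R[i]) :
  vec2 yp dyp = transfer_matrix m n *m vec2 ym dym ->
  transmitted m n ym yp dym dyp.
Proof.
move=> /matrixP E.
have := E 0 0; have := E 1 0; rewrite !mxE !big_ord_recr !big_ord0/= !mxE/= => E1 E0.
by split; rewrite ?E1 E0; ring.
Qed.

(** The matrix has determinant 1; its inverse is its adjugate. *)
Lemma transfer_matrix_unit (m n : R[i]) : transfer_matrix m n \in unitmx.
Proof.
pose S : 'M[R[i]]_2 := \matrix_(i < 2, j < 2)
  if i == 0 then (if j == 0 then 1 + m * n else - n) else (if j == 0 then - m else 1).
have E : transfer_matrix m n *m S = 1%:M.
  apply/matrixP => -[[|[|//]] ?] [[|[|//]] ?]; rewrite !mxE !big_ord_recr !big_ord0/= !mxE/=; ring.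
by case: (mulmx1_unit E).
Qed.

Record coupled_solution (a b : R) q lam (m n : R[i]) w dw (wm wp dwm dwp : R[i]) : Prop :=
  CoupledSolution {
    coupled_left : twice_differentiable (left_part a) w dw (fun x => (q x - lam) * w x);
    coupled_right : twice_differentiable (right_part b) w dw (fun x => (q x - lam) * w x);
    coupled_limits : one_sided_limits w wm wp;
    coupled_derivative_limits : one_sided_limits dw dwm dwp;
    coupled_transmitted : transmitted m n wm wp dwm dwp }.

Lemma is_u_coupled (a b : R) q (alpha : R) (m n : R[i]) lam u du :
  is_u a b q alpha (transfer_matrix m n) lam u du ->
  exists um up dum dup, coupled_solution a b q lam m n u du um up dum dup.
Proof.
move=> [[ddl ul] [ddr ur] _ [um [up [dum [dup [lu ldu uT]]]]]].
exists um, up, dum, dup; split; [exact: homogeneous_twice_differentiable ul|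
  exact: homogeneous_twice_differentiable ur|exact: lu|exact: ldu|].
exact: transfer_matrixP.
Qed.

(** Although [v] is continued from the right to the left by the inverse
    matrix, it satisfies the same transmission conditions as [u]. *)
Lemma is_v_coupled (a b : R) q (beta : R) (m n : R[i]) lam v dv :
  is_v a b q beta (transfer_matrix m n) lam v dv ->
  exists vm vp dvm dvp, coupled_solution a b q lam m n v dv vm vp dvm dvp.
Proof.
move=> [[ddl vl] [ddr vr] _ [vm [vp [dvm [dvp [lv ldv vT]]]]]].
exists vm, vp, dvm, dvp; split; [exact: homogeneous_twice_differentiable vl|
  exact: homogeneous_twice_differentiable vr|exact: lv|exact: ldv|].
apply: transfer_matrixP; rewrite vT mulKVmx//; exact: transfer_matrix_unit.
Qed.

(** A constant function is equal to its limit. *)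
Lemma wronskian_limit J k u du v dv (u0 du0 v0 dv0 : R[i]) : one_side J ->
  twice_differentiable J u du (fun x => k x * u x) ->
  twice_differentiable J v dv (fun x => k x * v x) ->
  u z @[z --> within J (nbhs (0:R))] --> (u0 : R[i]^o) ->
  du z @[z --> within J (nbhs (0:R))] --> (du0 : R[i]^o) ->
  v z @[z --> within J (nbhs (0:R))] --> (v0 : R[i]^o) ->
  dv z @[z --> within J (nbhs (0:R))] --> (dv0 : R[i]^o) ->
  forall x, J x -> wronskian u du v dv x = u0 * dv0 - du0 * v0.
Proof.
move=> oJ us vs uu0 dudu0 vv0 dvdv0 x Jx.
have FF := one_side_proper oJ.
apply: (@cvgC_const _ _ (within J (nbhs (0:R))) _ (wronskian u du v dv)).
  apply: (filterS _ (withinT J (nbhs_filter (0:R)))) => z Jz.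
  exact: (wronskian_constant (one_side_itv oJ) us vs).
exact: (cvgCD (cvgCM uu0 dvdv0) (cvgCN (cvgCM dudu0 vv0))).
Qed.

(** The transfer matrix has determinant 1, so it preserves the value
    [y z' - y' z] of the boundary data of two solutions; the constant on the right
    of 0 is therefore the one on the left. *)
Lemma coupled_wronskian (a b : R) q lam (m n : R[i]) u du v dv
    um up dum dup vm vp dvm dvp : 0 < a -> 0 < b ->
  coupled_solution a b q lam m n u du um up dum dup ->
  coupled_solution a b q lam m n v dv vm vp dvm dvp ->
  forall x, (left_part a `|` right_part b) x ->
    wronskian u du v dv x = um * dvm - dum * vm.
Proof.
move=> a0 b0 [ul ur [u1 u2] [u3 u4] [uE duE]] [vl vr [v1 v2] [v3 v4] [vE dvE]].
rewrite (at_left_left_part a0) in u1 u3 v1 v3.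
rewrite (at_right_right_part b0) in u2 u4 v2 v4.
move=> x [Jx|Jx].
  exact: (wronskian_limit (left_part_one_side a0) ul vl u1 u3 v1 v3).
rewrite (wronskian_limit (right_part_one_side b0) ur vr u2 u4 v2 v4 Jx).
by rewrite dvE duE vE uE; ring.
Qed.

Lemma coupled_weighted_integrable (a b : R) q lam (m n : R[i]) w dw
    wm wp dwm dwp h : 0 < a -> 0 < b ->
  coupled_solution a b q lam m n w dw wm wp dwm dwp ->
  square_integrable `](- a), b[ h ->
  complex_integrable `](- a), b[ (fun x => w x * h x).
Proof.
move=> a0 b0 [wl wr [w1 w2] _ _] hL2.
rewrite (at_left_left_part a0) in w1; rewrite (at_right_right_part b0) in w2.
have ol := left_part_one_side a0; have or := right_part_one_side b0.
have cl x := @twice_differentiable_continuous _ _ _ _ _ x wl.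
have cr x := @twice_differentiable_continuous _ _ _ _ _ x wr.
have [Kl Kl0 wKl] := one_side_bounded ol cl w1.
have [Kr Kr0 wKr] := one_side_bounded or cr w2.
have [mRl mIl] := continuous_in_measurable (one_side_measurable ol) cl.
have [mRr mIr] := continuous_in_measurable (one_side_measurable or) cr.
have mR := measurable_fun_two_sides mRl mRr.
have mI := measurable_fun_two_sides mIl mIr.
apply: (weighted_integrable (K := Kl + Kr + normc (w 0)) mR mI _ hL2).
move=> x /andP[ax xb]; have w00 := normc_ge0 (w 0).
have [x0|x0|->] := ltgtP x 0; last lra.
  have := wKl x; rewrite /left_part/= in_itv/= (ltW ax) x0 => /(_ isT); lra.
have := wKr x; rewrite /right_part/= in_itv/= (ltW xb) x0 => /(_ isT); lra.
Qed.

(** The halves [[-a, 0[] and []0, b]] contain one endpoint each that is not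
    in []-a, b[]. *)
Lemma square_integrable_subset D J (c : R) h : measurable D -> measurable J ->
  J `\ c `<=` D -> square_integrable D h -> square_integrable J h.
Proof.
move=> mD mJ JD [hR hI hi].
have m1 : measurable ([set c] : set R) by exact: measurable_set1.
have mJc : measurable (J `\ c) by exact: measurableD.
have ext (f : R -> R) : measurable_fun D f -> measurable_fun J f.
  move=> mf; apply: (@measurable_funS _ _ _ _ ((J `\ c) `|` [set c])).
  - exact: measurableU.
  - by move=> x Jx; have [->|/eqP xc] := eqVneq x c; [right|left].
  - apply/measurable_funU; [exact: mJc|exact: m1|].
    by split; [exact: (measurable_funS mD JD mf)|exact: measurable_fun_set1].
split; [exact: ext|exact: ext|].
apply/(@negligible_integrable _ _ _ mu J [set c]); [exact: m1|exact: mJ| | |].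
- by apply/measurable_EFinP; apply: measurable_funD; apply: measurable_funX; exact: ext.
- exact: lebesgue_measure_set1.
- exact: integrableS hi.
Qed.

Lemma square_integrable0 D : measurable D -> square_integrable D (fun=> 0 : R[i]).
Proof.
move=> mD; split; [exact: measurable_cst|exact: measurable_cst|].
rewrite (_ : (fun x => _) = cst 0%E); last by apply/funext => x; rewrite /= expr0n/= addr0.
exact: integrable0.
Qed.

End coupling.

(** * The boundary value problem *)
Section boundary_value_problem.
Context {R : realType}.
Local Notation mu := (@lebesgue_measure R).
Implicit Types (J D : set R) (f k q h y dy u du v dv w dw : R -> R[i]).

Lemma left_part_interior (a b : R) : 0 < b -> left_part a `\ (- a) `<=` `](- a), b[.
Proof.
move=> b0 x [] /=; rewrite /left_part/= !in_itv/= => /andP[ax x0] /eqP xa.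
by rewrite lt_neqAle eq_sym xa ax (lt_trans x0 b0).
Qed.

Lemma right_part_interior (a b : R) : 0 < a -> right_part b `\ b `<=` `](- a), b[.
Proof.
move=> a0 x [] /=; rewrite /right_part/= !in_itv/= => /andP[x0 xb] /eqP xb'.
by rewrite [x < b]lt_neqAle xb' xb andbT (lt_trans _ x0)// oppr_lt0.
Qed.

(** The membership in [L^2] of [y], [y'] and [ell y] follows from the existence
    of the one-sided limits at 0. *)
Lemma bvp_solution_intro (a b : R) q (alpha beta : R) (N M : nat)
    (eta kappa xi zeta : R) (c bb : 'I_N -> R) (d aa : 'I_M -> R) (lam : R[i])
    h y dy (ym yp dym dyp : R[i]) : 0 < a -> 0 < b ->
  square_integrable `](- a), b[ h ->
  ~ is_pole c lam -> ~ is_pole d lam ->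
  twice_differentiable (left_part a) y dy (fun x => (q x - lam) * y x + h x) ->
  twice_differentiable (right_part b) y dy (fun x => (q x - lam) * y x + h x) ->
  one_sided_limits y ym yp -> one_sided_limits dy dym dyp ->
  transmitted (mu_coef eta xi c bb lam) (nu_coef kappa zeta d aa lam) ym yp dym dyp ->
  y (- a) * (cos alpha)%:C = dy (- a) * (sin alpha)%:C ->
  y b * (cos beta)%:C = dy b * (sin beta)%:C ->
  bvp_solution a b q alpha beta eta kappa xi zeta c bb d aa lam h y dy.
Proof.
move=> a0 b0 hL2 cl dl yl yr ylim dylim [E dE] bca bcb.
have mD : measurable (`](- a), b[ : set R) by exact: measurable_itv.
have ol := left_part_one_side a0; have orr := right_part_one_side b0.
split; [ | |exact: bca|exact: bcb|].
- move: ylim.1 dylim.1; rewrite (at_left_left_part a0) => y0 dy0.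
  apply: (L2_solution ol _ yl y0 dy0).
  by apply: (square_integrable_subset mD (one_side_measurable ol) _ hL2);
    exact: left_part_interior.
- move: ylim.2 dylim.2; rewrite (at_right_right_part b0) => y0 dy0.
  apply: (L2_solution orr _ yr y0 dy0).
  by apply: (square_integrable_subset mD (one_side_measurable orr) _ hL2);
    exact: right_part_interior.
- exists ym, yp, dym, dyp; split; [exact: ylim|exact: dylim| |].
    by split=> // _; rewrite dE; ring.
  by split=> // _; rewrite E; ring.
Qed.

Lemma derivative_of_zero (b : R) w dw : 0 < b ->
  has_derivative_in (right_part b) w b (dw b) ->
  (forall x, right_part b x -> w x = 0) -> dw b = 0.
Proof.
move=> b0 /has_derivative_inP wd w0; apply: normc_le_eps_eq0 => e e0.
have [r r0 hr] := wd _ e0.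
(* A point b - t of the half interval, different from b and within r of it. *)
pose t := Num.min (b / 2) (r / 2).
have t0 : 0 < t by rewrite lt_min; apply/andP; lra.
have tb : t <= b / 2 by rewrite ge_min lexx.
have tr : t <= r / 2 by rewrite ge_min lexx orbT.
have tE : `|b - t - b| = t by rewrite addrAC subrr sub0r normrN gtr0_norm.
have Jt : right_part b (b - t) by rewrite /right_part/= in_itv/=; apply/andP; lra.
have Jb : right_part b b by rewrite /right_part/= in_itv/= lexx b0.
have := hr _ Jt; rewrite tE !w0// subrr sub0r normc_oppE normcM normc_real tE.
have -> : t < r by lra.
by move=> /(_ isT); rewrite mulrC ler_pM2r.
Qed.

(** A function vanishing on []0, b]] would have zero derivative at [b], but
    sine and cosine have no common zero. *)
Lemma solution_nonzero (b beta : R) w dw : 0 < b ->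
  has_derivative_in (right_part b) w b (dw b) ->
  w b = (sin beta)%:C -> dw b = (cos beta)%:C ->
  exists2 x, right_part b x & w x != 0.
Proof.
move=> b0 wd wb dwb; apply: contrapT => nw.
have w0 x : right_part b x -> w x = 0.
  by move=> Jx; apply/eqP/negPn/negP => wx; apply: nw; exists x.
have Jb : right_part b b by rewrite /right_part/= in_itv/= lexx b0.
have /eqP := derivative_of_zero b0 wd w0; rewrite dwb => /eqP/complexI c0.
have := w0 _ Jb; rewrite wb => /complexI s0.
have := cos2Dsin2 beta; rewrite c0 s0 expr0n addr0 => /esym/eqP.
by rewrite oner_eq0.
Qed.

(** If the Wronskian is zero, then at [-a] the data of [v] are proportional to
    those of [u], and [v] is an eigenfunction. *)
Lemma wronskian_nonzero (a b : R) q (alpha beta : R) (N M : nat)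
    (eta kappa xi zeta : R) (c bb : 'I_N -> R) (d aa : 'I_M -> R) (lam : R[i])
    u du v dv (um up dum dup vm vp dvm dvp : R[i]) : 0 < a -> 0 < b ->
  ~ is_pole c lam -> ~ is_pole d lam ->
  ~ is_eigenvalue a b q alpha beta eta kappa xi zeta c bb d aa lam ->
  coupled_solution a b q lam (mu_coef eta xi c bb lam) (nu_coef kappa zeta d aa lam)
    u du um up dum dup ->
  coupled_solution a b q lam (mu_coef eta xi c bb lam) (nu_coef kappa zeta d aa lam)
    v dv vm vp dvm dvp ->
  u (- a) = (sin alpha)%:C -> du (- a) = (cos alpha)%:C ->
  v b = (sin beta)%:C -> dv b = (cos beta)%:C ->
  um * dvm - dum * vm != 0.
Proof.
move=> a0 b0 cl dl neig uc vc ua dua vb dvb; apply/negP => /eqP W0.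
have Ja : (left_part a `|` right_part b) (- a).
  by left; rewrite /left_part/= in_itv/= lexx oppr_lt0.
have := coupled_wronskian a0 b0 uc vc Ja; rewrite W0 /wronskian ua dua => Wa.
have [vl vr vlim dvlim vT] := vc.
have Jb : right_part b b by rewrite /right_part/= in_itv/= lexx b0.
apply: neig; exists v, dv; split.
  have mD : measurable (`](- a), b[ : set R) by exact: measurable_itv.
  have E0 : (fun x => (q x - lam) * v x + 0) = (fun x => (q x - lam) * v x).
    by apply/funext => x; rewrite addr0.
  apply: (bvp_solution_intro a0 b0 (square_integrable0 mD) cl dl _ _ vlim dvlim vT).
  - by rewrite E0.
  - by rewrite E0.
  - by apply/eqP; rewrite -subr_eq0 -[X in _ == X]oppr0 -Wa; apply/eqP; ring.
  - by rewrite vb dvb mulrC.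
have [vd _ _] := vr.
have [x Jx vx] := solution_nonzero b0 (vd b Jb) vb dvb.
by exists x => //; right.
Qed.

End boundary_value_problem.

Lemma variation_limit (R : realType) (F : set_system R) (FF : Filter F)
    (f g P Q : R -> R[i]) (f0 g0 P0 Q0 k : R[i]) :
  f x @[x --> F] --> (f0 : R[i]^o) -> g x @[x --> F] --> (g0 : R[i]^o) ->
  P x @[x --> F] --> (P0 : R[i]^o) -> Q x @[x --> F] --> (Q0 : R[i]^o) ->
  ((f x * P x + g x * Q x) * k) @[x --> F] --> ((f0 * P0 + g0 * Q0) * k : R[i]^o).
Proof.
move=> ff gg PP QQ; apply: cvgCM; last exact: (@cvg_cst R[i]^o).
exact: (cvgCD (cvgCM ff PP) (cvgCM gg QQ)).
Qed.

Theorem theorem3p1 (R : realType)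
  (a b : R) (a_gt0 : 0 < a) (b_gt0 : 0 < b)
  (q : R -> R[i]) (q_L2 : square_integrable `](- a), b[%classic q)
  (alpha beta : R) (alpha_bnd : 0 <= alpha < pi) (beta_bnd : 0 < beta <= pi)
  (N M : nat) (eta kappa xi zeta : R) (eta_ge0 : 0 <= eta) (kappa_ge0 : 0 <= kappa)
  (c bb : 'I_N -> R) (c_incr : forall i j : 'I_N, (i < j)%N -> c i < c j)
  (bb_gt0 : forall i, 0 < bb i)
  (d aa : 'I_M -> R) (d_incr : forall i j : 'I_M, (i < j)%N -> d i < d j)
  (aa_gt0 : forall j, 0 < aa j)
  (lam : R[i]) (lam_Omega : ~ is_pole c lam /\ ~ is_pole d lam)
  (lam_not_eigenvalue :
     ~ is_eigenvalue a b q alpha beta eta kappa xi zeta c bb d aa lam)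
  (u du v dv : R -> R[i])
  (uP : is_u a b q alpha
          (transfer_matrix (mu_coef eta xi c bb lam) (nu_coef kappa zeta d aa lam))
          lam u du)
  (vP : is_v a b q beta
          (transfer_matrix (mu_coef eta xi c bb lam) (nu_coef kappa zeta d aa lam))
          lam v dv)
  (* the point at which the (constant) Wronskian is evaluated *)
  (x0 : R) (x0_dom : (left_part a `|` right_part b) x0) :
  let psi := wronskian u du v dv x0 in
  let G := green u v psi in
  psi != 0 /\
  forall h : R -> R[i], square_integrable `](- a), b[%classic h ->
    let g := fun x => complex_integral `](- a), b[%classic (fun t => G x t * h t) in
    (forall x, (left_part a `|` right_part b) x ->
       complex_integrable `](- a), b[%classic (fun t => G x t * h t)) /\
    exists dg : R -> R[i],
      bvp_solution a b q alpha beta eta kappa xi zeta c bb d aa lam h g dg.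
Proof.
move=> psi G; have [cl dl] := lam_Omega.
have [um [up [dum [dup uc]]]] := is_u_coupled uP.
have [vm [vp [dvm [dvp vc]]]] := is_v_coupled vP.
have [_ _ [ua dua] _] := uP; have [_ _ [vb dvb] _] := vP.
have W := coupled_wronskian a_gt0 b_gt0 uc vc.
have psiE : psi = um * dvm - dum * vm by exact: W.
have psi0 : psi != 0.
  rewrite psiE.
  exact: (wronskian_nonzero a_gt0 b_gt0 cl dl lam_not_eigenvalue uc vc ua dua vb dvb).
split; first exact: psi0.
move=> h hL2 g.
pose D : set R := `](- a), b[%classic.
have mD : measurable D by exact: measurable_itv.
have ui := coupled_weighted_integrable a_gt0 b_gt0 uc hL2.
have vi := coupled_weighted_integrable a_gt0 b_gt0 vc hL2.
split; first by move=> x _; exact: (green_integrable psi x mD ui vi).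
pose P := primitive (cutoff D (fun t => u t * h t)).
pose k2 := cutoff D (fun t => v t * h t).
pose Q x := complex_integral setT k2 + - 1 * primitive k2 x.
have gE : g = fun x => (v x * P x + u x * Q x) * psi^-1.
  by apply/funext => x; exact: (green_integral psi x mD ui vi).
have Wl x : left_part a x -> wronskian u du v dv x = psi.
  by move=> Jx; rewrite psiE; apply: W; left.
have Wr x : right_part b x -> wronskian u du v dv x = psi.
  by move=> Jx; rewrite psiE; apply: W; right.
have [ul ur ulim dulim [uT duT]] := uc; have [vl vr vlim dvlim [vT dvT]] := vc.
have gl := green_side (left_part_one_side a_gt0) mD (@left_part_interior _ a b b_gt0)
  ul vl Wl psi0 ui vi.
have gr := green_side (right_part_one_side b_gt0) mD (@right_part_interior _ a b a_gt0)
  ur vr Wr psi0 ui vi.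
have ui' := (complex_integrable_cutoff _ mD).1 ui.
have vi' := (complex_integrable_cutoff _ mD).1 vi.
have Pc J : P z @[z --> within J (nbhs (0:R))] --> (P 0 : R[i]^o) by exact: primitive_cvg.
have Qc J : Q z @[z --> within J (nbhs (0:R))] --> (Q 0 : R[i]^o).
  apply: cvgCD; first exact: (@cvg_cst R[i]^o).
  by apply: cvgCM; [exact: (@cvg_cst R[i]^o)|exact: primitive_cvg].
have Pa : P (- a) = 0 by exact: primitive_cutoff_left.
have Qb : Q b = 0 by rewrite /Q primitive_cutoff_right; ring.
have lim f1 f2 f1m f1p f2m f2p : one_sided_limits f1 f1m f1p ->
    one_sided_limits f2 f2m f2p ->
    one_sided_limits (fun x => (f1 x * P x + f2 x * Q x) * psi^-1)
      ((f1m * P 0 + f2m * Q 0) * psi^-1) ((f1p * P 0 + f2p * Q 0) * psi^-1).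
  rewrite /one_sided_limits (at_left_left_part a_gt0) (at_right_right_part b_gt0).
  by move=> [m1 p1] [m2 p2]; split; apply: variation_limit;
    [exact: m1|exact: m2|exact: Pc|exact: Qc|exact: p1|exact: p2|exact: Pc|exact: Qc].
exists (fun x => (dv x * P x + du x * Q x) * psi^-1); rewrite gE.
apply: (bvp_solution_intro a_gt0 b_gt0 hL2 cl dl gl gr (lim _ _ _ _ _ _ vlim ulim)
  (lim _ _ _ _ _ _ dvlim dulim)).
- by split; rewrite ?vT ?uT ?dvT ?duT ?vT ?uT; ring.
- by rewrite -/P Pa ua dua; ring.
- by rewrite -/k2 -/(Q b) Qb vb dvb; ring.
Qed.
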